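(* A right-angled Artin group $A\Gamma$ is poly-fg-free of length $2$ if and only if $\Gamma$ is a finite tree or a finite complete bipartite graph.
   Context: All graphs are simple undirected graphs $\Gamma=(V(\Gamma),E(\Gamma))$ (no loops or multiple edges), possibly infinite. The right-angled Artin group $A\Gamma$ is the group with generators in one-to-one correspondence with the vertex set $V(\Gamma)$ and defining relations $vw=wv$ for each edge $\{v,w\}\in E(\Gamma)$. A group $G$ is poly-fg-free (poly-finitely-generated-free) if there is a finite tower of subgroups $1=G_0\trianglelefteq G_1\trianglelefteq\cdots\trianglelefteq G_N=G$ (each $G_i$ normal in $G_{i+1}$) such that each quotient $G_{i+1}/G_i$ is a finitely generated free group; the length is the least natural number $N$ for which such a tower exists.
   Formalization: The one-vertex tree is excluded (its group is Z, of length 1, so the literal claim fails there), and a complete bipartite graph is taken to have two nonempty sides. *)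

(* Defs.v *)
From HB Require Import structures.
From mathcomp Require Import all_boot.
From mathcomp Require Import generic_quotient.
From mathcomp Require Import boolp classical_sets cardinality.

Set Implicit Arguments.
Unset Strict Implicit.
Unset Printing Implicit Defensive.

Local Open Scope group_scope.
Local Open Scope quotient_scope.

(* The vertex set may be infinite. Taking it to be a choiceType and adjacency *)
(* to be boolean is no restriction, by excluded middle and choice.            *)
Record simple_graph := SimpleGraph {
  vertex :> choiceType;
  adj : rel vertex;
  adj_sym : symmetric adj;
  adj_irrefl : irreflexive adj
}.
Arguments adj {_}.

Definition finite_graph (Gam : simple_graph) : Prop :=
  finite_set [set: vertex Gam].

Definition connected_graph (Gam : simple_graph) : Prop :=
  inhabited Gam /\
  forall u v : Gam, exists2 p : seq Gam, path adj u p & last u p = v.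

(* A duplicate-free closed walk with at least three vertices is a cycle of    *)
(* the graph; with two vertices it only runs back and forth along an edge.    *)
Definition acyclic_graph (Gam : simple_graph) : Prop :=
  forall c : seq Gam, 2 < size c -> ~ ucycle adj c.

Definition is_tree (Gam : simple_graph) : Prop :=
  connected_graph Gam /\ acyclic_graph Gam.

(* A and its complement are the two sides; both must be nonempty. *)
Definition is_complete_bipartite (Gam : simple_graph) : Prop :=
  exists A : {pred Gam},
    [/\ exists u : Gam, u \in A,
        exists v : Gam, v \notin A
      & forall u v : Gam, adj u v = ((u \in A) != (v \in A))].

(* The letter (x, true) stands for the generator x, (x, false) for x^-1. *)
Definition word (X : choiceType) := seq (X * bool).

Definition word_inv (X : choiceType) (w : word X) : word X :=
  rev [seq (a.1, ~~ a.2) | a <- w].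

Section Presentation.
Variables (X : choiceType) (R : word X -> word X -> Prop).

Inductive pres_eq : word X -> word X -> Prop :=
| pres_refl u : pres_eq u u
| pres_sym u v : pres_eq u v -> pres_eq v u
| pres_trans u v w : pres_eq u v -> pres_eq v w -> pres_eq u w
| pres_cancel p q x b : pres_eq (p ++ [:: (x, b); (x, ~~ b)] ++ q) (p ++ q)
| pres_rel p q u v : R u v -> pres_eq (p ++ u ++ q) (p ++ v ++ q).

Lemma pres_ctx p q u v : pres_eq u v -> pres_eq (p ++ u ++ q) (p ++ v ++ q).
Proof.
elim=> {u v} [u|u v _ IH|u v w _ IH1 _ IH2|p' q' x b|p' q' u v Ruv].
- exact: pres_refl.
- exact: pres_sym.
- exact: pres_trans IH1 IH2.
- have := pres_cancel (p ++ p') (q' ++ q) x b.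
  by rewrite /= -!catA /=.
- have := pres_rel (p ++ p') (q' ++ q) Ruv.
  by rewrite -!catA.
Qed.

Lemma pres_cat u u' v v' :
  pres_eq u u' -> pres_eq v v' -> pres_eq (u ++ v) (u' ++ v').
Proof.
move=> uu' vv'; apply: (@pres_trans _ (u' ++ v)).
  exact: (pres_ctx [::] v uu').
by have := pres_ctx u' [::] vv'; rewrite !cats0.
Qed.

Lemma word_invK : involutive (@word_inv X).
Proof.
move=> w; rewrite /word_inv map_rev revK -map_comp -[RHS]map_id.
by apply: eq_map => -[x b] /=; rewrite negbK.
Qed.

Lemma pres_mulV w : pres_eq (w ++ word_inv w) [::].
Proof.
elim: w => [|[x b] w IH]; first exact: pres_refl.
rewrite /word_inv /= rev_cons -cats1 -/(word_inv w).
apply: (@pres_trans _ ([:: (x, b)] ++ [::] ++ [:: (x, ~~ b)])).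
  by have := pres_ctx [:: (x, b)] [:: (x, ~~ b)] IH; rewrite -!catA.
exact: (pres_cancel [::] [::] x b).
Qed.

Lemma pres_mulVl w : pres_eq (word_inv w ++ w) [::].
Proof. by have := pres_mulV (word_inv w); rewrite word_invK. Qed.

Lemma pres_inv u v : pres_eq u v -> pres_eq (word_inv u) (word_inv v).
Proof.
move=> uv; apply: (@pres_trans _ (word_inv u ++ (v ++ word_inv v))).
  have := pres_cat (pres_refl (word_inv u)) (pres_sym (pres_mulV v)).
  by rewrite cats0.
apply: (@pres_trans _ (word_inv u ++ (u ++ word_inv v))).
  apply: pres_cat (pres_refl _) _.
  exact: pres_cat (pres_sym uv) (pres_refl _).
by rewrite catA; apply: (pres_cat (pres_mulVl u) (pres_refl (word_inv v))).
Qed.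

Definition pres_rel_op : rel (word X) := fun u v => `[< pres_eq u v >].

Lemma pres_rel_op_refl : reflexive pres_rel_op.
Proof. by move=> u; apply/asboolP; exact: pres_refl. Qed.

Lemma pres_rel_op_sym : symmetric pres_rel_op.
Proof. by move=> u v; apply/asboolP/asboolP; exact: pres_sym. Qed.

Lemma pres_rel_op_trans : transitive pres_rel_op.
Proof. by move=> v u w /asboolP uv /asboolP vw; apply/asboolP/(pres_trans uv). Qed.

Canonical pres_equiv :=
  EquivRel pres_rel_op pres_rel_op_refl pres_rel_op_sym pres_rel_op_trans.

(* The group < X | u = v for all u, v with R u v >. *)
Definition presented := {eq_quot pres_equiv}.

HB.instance Definition _ := Choice.on presented.

Definition pres_class (w : word X) : presented := \pi_{eq_quot pres_equiv} w.

Definition presented_mul (a b : presented) : presented :=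
  pres_class (repr a ++ repr b).
Definition presented_one : presented := pres_class [::].
Definition presented_inv (a : presented) : presented :=
  pres_class (word_inv (repr a)).

Lemma pres_classP u v : pres_class u = pres_class v <-> pres_eq u v.
Proof. by split=> [/eqmodP/asboolP//|uv]; apply/eqmodP/asboolP. Qed.

Lemma repr_classK a : pres_class (repr a) = a.
Proof. exact: reprK. Qed.

Lemma repr_class w : pres_eq (repr (pres_class w)) w.
Proof. by apply/pres_classP; rewrite repr_classK. Qed.

Lemma presented_mulE u v :
  presented_mul (pres_class u) (pres_class v) = pres_class (u ++ v).
Proof. by apply/pres_classP; apply: pres_cat; apply: repr_class. Qed.

Lemma presented_mulA : associative presented_mul.
Proof.
move=> a b c; rewrite -(repr_classK a) -(repr_classK b) -(repr_classK c).
by rewrite !presented_mulE catA.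
Qed.

Lemma presented_mul1 : left_id presented_one presented_mul.
Proof. by move=> a; rewrite -(repr_classK a) presented_mulE. Qed.

Lemma presented_mulr1 : right_id presented_one presented_mul.
Proof. by move=> a; rewrite -(repr_classK a) presented_mulE cats0. Qed.

Lemma presented_mulV : left_inverse presented_one presented_inv presented_mul.
Proof.
move=> a; rewrite -{2}(repr_classK a) presented_mulE.
by apply/pres_classP/pres_mulVl.
Qed.

Lemma presented_mulrV : right_inverse presented_one presented_inv presented_mul.
Proof.
move=> a; rewrite -{1}(repr_classK a) presented_mulE.
by apply/pres_classP/pres_mulV.
Qed.

HB.instance Definition _ := isGroup.Build presented
  presented_mulA presented_mul1 presented_mulr1 presented_mulV presented_mulrV.

End Presentation.

Definition free_group (X : choiceType) : groupType :=
  presented (fun _ _ : word X => False).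

Inductive raag_rel (Gam : simple_graph) : word Gam -> word Gam -> Prop :=
| RaagRel (v w : Gam) : adj v w ->
    raag_rel [:: (v, true); (w, true)] [:: (w, true); (v, true)].

Definition raag (Gam : simple_graph) : groupType := presented (@raag_rel Gam).

Definition group_isomorphic (G H : groupType) : Prop :=
  exists f : {multiplicative G -> H}, bijective f.

(* n = 0 is allowed: the trivial group is free of rank 0. *)
Definition fg_free (G : groupType) : Prop :=
  exists n : nat, group_isomorphic (free_group 'I_n) G.

Definition normal_in (G : groupType) (H K : groupClosed G) : Prop :=
  {subset H <= K} /\ {in H & K, forall x y, x ^ y \in H}.

Definition subgroup_type (G : groupType) (K : groupClosed G) :=
  {x : G | x \in K}.

HB.instance Definition _ (G : groupType) (K : groupClosed G) :=
  SubChoice.on (subgroup_type K).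

Lemma subgroup_group_closed (G : groupType) (K : groupClosed G) :
  group_closed (fun x : G => x \in K).
Proof. by split=> [|x y]; [exact: gpred1 | exact: gpredF]. Qed.

HB.instance Definition _ (G : groupType) (K : groupClosed G) :=
  SubChoice_isSubGroup.Build G _ (subgroup_type K) (subgroup_group_closed K).

Section Quotient.
Variables (G : groupType) (H K : groupClosed G) (nHK : normal_in H K).
Implicit Types x y z : subgroup_type K.

Definition coset_rel : rel (subgroup_type K) :=
  fun x y => (val x)^-1 * val y \in H.

Lemma coset_rel_refl : reflexive coset_rel.
Proof. by move=> x; rewrite /coset_rel mulVg gpred1. Qed.

Lemma coset_rel_sym : symmetric coset_rel.
Proof. by move=> x y; rewrite /coset_rel -gpredV invgM invgK. Qed.

Lemma coset_rel_trans : transitive coset_rel.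
Proof.
move=> y x z xy yz; rewrite /coset_rel.
by have := gpredM _ _ xy yz; rewrite mulgA mulgK.
Qed.

Canonical coset_equiv :=
  EquivRel coset_rel coset_rel_refl coset_rel_sym coset_rel_trans.

(* The group K / H of left cosets x H with x in K. It depends on the proof    *)
(* nHK because only normality makes the multiplication below a group law.     *)
Definition quotient_group := let _ := nHK in {eq_quot coset_equiv}.

HB.instance Definition _ := Choice.copy quotient_group {eq_quot coset_equiv}.

Definition coset_class x : quotient_group := \pi_{eq_quot coset_equiv} x.
Definition coset_repr (a : quotient_group) : subgroup_type K :=
  repr (a : {eq_quot coset_equiv}).

Definition quotient_mul (a b : quotient_group) : quotient_group :=
  coset_class (coset_repr a * coset_repr b).
Definition quotient_one : quotient_group := coset_class 1.
Definition quotient_inv (a : quotient_group) : quotient_group :=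
  coset_class (coset_repr a)^-1.

Lemma coset_classP x y : coset_class x = coset_class y <-> coset_rel x y.
Proof. by split=> [/eqmodP//|xy]; apply/eqmodP. Qed.

Lemma coset_reprK a : coset_class (coset_repr a) = a.
Proof. exact: reprK. Qed.

Lemma repr_coset x : coset_rel (coset_repr (coset_class x)) x.
Proof. by apply/coset_classP; rewrite coset_reprK. Qed.

Lemma coset_relM x x' y y' :
  coset_rel x x' -> coset_rel y y' -> coset_rel (x * y) (x' * y').
Proof.
rewrite /coset_rel => xx' yy'; rewrite !valM.
have Hc := nHK.2 _ (val y) xx' (valP y).
have := gpredM _ _ Hc yy'.
by rewrite /conjg invgM !mulgA mulgK.
Qed.

Lemma quotient_mulE x y :
  quotient_mul (coset_class x) (coset_class y) = coset_class (x * y).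
Proof. by apply/coset_classP; apply: coset_relM; apply: repr_coset. Qed.

Lemma quotient_mulA : associative quotient_mul.
Proof.
move=> a b c; rewrite -(coset_reprK a) -(coset_reprK b) -(coset_reprK c).
by rewrite !quotient_mulE mulgA.
Qed.

Lemma quotient_mul1 : left_id quotient_one quotient_mul.
Proof. by move=> a; rewrite -(coset_reprK a) quotient_mulE mul1g. Qed.

Lemma quotient_mulr1 : right_id quotient_one quotient_mul.
Proof. by move=> a; rewrite -(coset_reprK a) quotient_mulE mulg1. Qed.

Lemma quotient_mulV : left_inverse quotient_one quotient_inv quotient_mul.
Proof. by move=> a; rewrite -{2}(coset_reprK a) quotient_mulE mulVg. Qed.

Lemma quotient_mulrV : right_inverse quotient_one quotient_inv quotient_mul.
Proof. by move=> a; rewrite -{1}(coset_reprK a) quotient_mulE mulgV. Qed.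

HB.instance Definition _ := isGroup.Build quotient_group
  quotient_mulA quotient_mul1 quotient_mulr1 quotient_mulV quotient_mulrV.

End Quotient.

(* 1 = T 0 <| T 1 <| ... <| T N = G; the values T i with i > N play no role. *)
Definition poly_fg_free_tower (G : groupType) (N : nat) : Prop :=
  exists T : nat -> groupClosed G,
    [/\ forall x : G, (x \in T 0) = (x == 1),
        forall x : G, x \in T N
      & forall i : nat, i < N ->
          exists nT : normal_in (T i) (T i.+1), fg_free (quotient_group nT)].

Definition poly_fg_free_of_length (G : groupType) (N : nat) : Prop :=
  poly_fg_free_tower G N /\ forall M : nat, poly_fg_free_tower G M -> N <= M.

(* Main.v *)
(* Suppose 1 -> N -> G -> Q -> 1 with G the Artin group of the graph, N and Q
   nontrivial free of finite rank. Since N is finitely generated, a derivation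
   from G to Z[G/K], with N <= K, restricts to N as a homomorphism whose values
   have supports in one finite set of cosets; that set is stable under G, so
   the derivation vanishes on N unless K has finite index. For the Fox
   derivative at a vertex [a] this means: if the exponent sum of [a] is nonzero
   on N, then N and the neighbours of [a] generate a subgroup of finite index.
   The second ingredient is that two commuting elements x, y of a free group
   satisfy alpha x * beta y = alpha y * beta x for all homomorphisms alpha and
   beta to Z, because (alpha, beta) lifts to the Heisenberg group.

   If Q has rank at least 2, the vertices in N and those outside N are the two
   sides of a complete bipartite graph. If Q has rank 1, a derivation that is
   principal on a union of components shows that the graph is connected, and
   a cycle contradicts the lift of the kernel to the Heisenberg group.
   Conversely, a retraction onto one side of a complete bipartite graph and,
   for a tree, the map sending all vertices to 1 have free kernels. *)
From HB Require Import structures.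
Require Import Defs.
From mathcomp Require Import all_boot all_algebra.
From mathcomp Require Import generic_quotient boolp classical_sets cardinality.
From mathcomp Require Import zify ring.

Set Implicit Arguments.
Unset Strict Implicit.
Unset Printing Implicit Defensive.

Import GRing.Theory.
Local Open Scope group_scope.

(** * Words, homomorphisms and the Heisenberg lift *)

Section Evaluation.
Variables (X : choiceType) (R : word X -> word X -> Prop).

Definition word_act (T : Type) (a : X * bool -> T -> T) (w : word X) (t : T) :=
  foldr a t w.

Lemma word_act_cat T (a : X * bool -> T -> T) u v t :
  word_act a (u ++ v) t = word_act a u (word_act a v t).
Proof. exact: foldr_cat. Qed.

(** This is how presented groups are made to act on sets: on reduced words, on pairs that encode
    derivations, and on the free kernel in the tree case. Since [b] takes both values, the first
    condition makes every letter act as a permutation. *)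
Lemma word_act_pres T (a : X * bool -> T -> T) :
  (forall x b t, a (x, b) (a (x, ~~ b) t) = t) ->
  (forall u v t, R u v -> word_act a u t = word_act a v t) ->
  forall u v, pres_eq R u v -> word_act a u =1 word_act a v.
Proof.
move=> aK aR u v; elim=> {u v} [//|u v _ IH t|u v w _ IH1 _ IH2 t||].
- by rewrite IH.
- by rewrite IH1 IH2.
- by move=> p q x b t; rewrite !word_act_cat /= aK.
- by move=> p q u v Ruv t; rewrite !word_act_cat (aR _ _ _ Ruv).
Qed.

Lemma pres_classM u v :
  pres_class R (u ++ v) = pres_class R u * pres_class R v.
Proof. by symmetry; apply: presented_mulE. Qed.

Lemma pres_class0 : pres_class R [::] = 1.
Proof. by []. Qed.

Lemma pres_ind (P : presented R -> Prop) :
  (forall w, P (pres_class R w)) -> forall g, P g.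
Proof. by move=> Pw g; rewrite -(repr_classK g). Qed.

Definition gen (x : X) : presented R := pres_class R [:: (x, true)].

Lemma pres_class_genV x : pres_class R [:: (x, false)] = (gen x)^-1.
Proof.
apply: (mulgI (gen x)); rewrite mulgV -pres_classM; apply/pres_classP.
exact: (pres_cancel R [::] [::] x true).
Qed.

Section Lift.
Variables (H : groupType) (h : X -> H).

Definition eval_letter (l : X * bool) := if l.2 then h l.1 else (h l.1)^-1.
Definition word_eval (w : word X) : H := foldr (fun l g => eval_letter l * g) 1 w.

Lemma word_eval_cat u v : word_eval (u ++ v) = word_eval u * word_eval v.
Proof. by elim: u => [|l u IH] /=; rewrite ?mul1g // IH mulgA. Qed.

Hypothesis hR : forall u v, R u v -> word_eval u = word_eval v.

Lemma word_eval_pres u v : pres_eq R u v -> word_eval u = word_eval v.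
Proof.
elim=> {u v} [//|u v _ IH|u v w _ IH1 _ IH2||].
- by rewrite IH.
- by rewrite IH1 IH2.
- by move=> p q x []; rewrite !word_eval_cat /= ?mulg1 ?mulgV ?mulVg mul1g.
- by move=> p q u v Ruv; rewrite !word_eval_cat (hR Ruv).
Qed.

Definition pres_lift (g : presented R) := word_eval (repr g).

Lemma pres_lift_class w : pres_lift (pres_class R w) = word_eval w.
Proof. exact/word_eval_pres/repr_class. Qed.

Lemma pres_lift_gen x : pres_lift (gen x) = h x.
Proof. by rewrite pres_lift_class /= mulg1. Qed.

Lemma pres_liftM : {morph pres_lift : x y / x * y}.
Proof.
move=> x y; rewrite -(repr_classK x) -(repr_classK y) -pres_classM.
by rewrite !pres_lift_class word_eval_cat.
Qed.
End Lift.

Lemma word_eval_gen w : word_eval gen w = pres_class R w.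
Proof.
elim: w => [|[x b] w IH] //=; rewrite IH -cat1s pres_classM.
by case: b; rewrite /eval_letter //= pres_class_genV.
Qed.

Lemma gen_ind (P : presented R -> Prop) :
  P 1 -> (forall x, P (gen x)) -> (forall g h, P g -> P h -> P (g * h)) ->
  (forall g, P g -> P g^-1) -> forall g, P g.
Proof.
move=> P1 Pgen PM PV; apply: pres_ind; elim=> [|[x b] w IH] //.
rewrite -cat1s pres_classM; apply: PM => //; case: b; first exact: Pgen.
by rewrite pres_class_genV; apply/PV/Pgen.
Qed.
End Evaluation.

Section Morphisms.
Variables (G H : groupType) (f : G -> H).
Hypothesis fM : {morph f : x y / x * y}.

Lemma morph_one : f 1 = 1.
Proof. by apply: (mulgI (f 1)); rewrite -fM !mulg1. Qed.

Lemma morph_inv : {morph f : x / x^-1}.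
Proof. by move=> x; apply: (mulgI (f x)); rewrite -fM !mulgV morph_one. Qed.

Lemma morph_exp n : {morph f : x / x ^+ n}.
Proof.
by move=> x; elim: n => [|n IH]; rewrite ?expg0 ?morph_one // !expgS fM IH.
Qed.

Lemma morph_word_eval (X : choiceType) (h : X -> G) w :
  f (word_eval h w) = word_eval (f \o h) w.
Proof.
elim: w => [|[x b] w IH] /=; first exact: morph_one.
by rewrite fM IH /eval_letter /=; case: b; rewrite ?morph_inv.
Qed.
End Morphisms.

Lemma eq_word_eval (X : choiceType) (H : groupType) (h h' : X -> H) :
  h =1 h' -> word_eval h =1 word_eval h'.
Proof. by move=> hh' w; elim: w => //= l w ->; rewrite /eval_letter hh'. Qed.

Lemma morph_gen_eq (X : choiceType) (R : word X -> word X -> Prop)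
    (H : groupType) (f f' : presented R -> H) :
  {morph f : x y / x * y} -> {morph f' : x y / x * y} ->
  (forall x, f (gen R x) = f' (gen R x)) -> f =1 f'.
Proof.
move=> fM f'M ff'; apply: gen_ind => //.
- by rewrite !morph_one.
- by move=> g h eg eh; rewrite fM f'M eg eh.
- by move=> g eg; rewrite !morph_inv // eg.
Qed.

Section Additive.
Variables (G : groupType) (f : G -> int).
Definition additive_on_group := forall x y, f (x * y) = (f x + f y)%R.
Hypothesis fM : additive_on_group.

Lemma add1 : f 1 = 0%R.
Proof. by have := fM 1 1; rewrite mulg1; lia. Qed.

Lemma addV x : f x^-1 = (- f x)%R.
Proof. by have := fM x x^-1; rewrite mulgV add1; lia. Qed.

Lemma addX x n : f (x ^+ n) = (f x * n%:Z)%R.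
Proof. by elim: n => [|n IH]; rewrite ?expg0 ?add1 ?expgS ?fM ?IH; lia. Qed.
End Additive.

Section ExponentSum.
Variables (X : choiceType) (R : word X -> word X -> Prop) (h : X -> int).

Definition letter_sum (l : X * bool) := if l.2 then h l.1 else (- h l.1)%R.
Definition word_sum (w : word X) := foldr (fun l s => (letter_sum l + s)%R) 0%R w.

Lemma word_sum_cat u v : word_sum (u ++ v) = (word_sum u + word_sum v)%R.
Proof. by elim: u => [|l u IH] /=; rewrite ?add0r // IH addrA. Qed.

Hypothesis hR : forall u v, R u v -> word_sum u = word_sum v.

Lemma word_sum_pres u v : pres_eq R u v -> word_sum u = word_sum v.
Proof.
elim=> {u v} [//|u v _ IH|u v w _ IH1 _ IH2||].
- by rewrite IH.
- by rewrite IH1 IH2.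
- by move=> p q x []; rewrite !word_sum_cat /= /letter_sum /=; lia.
- by move=> p q u v Ruv; rewrite !word_sum_cat (hR Ruv).
Qed.

Definition exp_sum (g : presented R) := word_sum (repr g).

Lemma exp_sum_class w : exp_sum (pres_class R w) = word_sum w.
Proof. exact/word_sum_pres/repr_class. Qed.

Lemma exp_sum_gen x : exp_sum (gen R x) = h x.
Proof. by rewrite exp_sum_class /= addr0. Qed.

Lemma exp_sumM : additive_on_group exp_sum.
Proof.
move=> x y; rewrite -(repr_classK x) -(repr_classK y) -pres_classM.
by rewrite !exp_sum_class word_sum_cat.
Qed.
End ExponentSum.

(* (alpha, gamma, beta) is a lift of (alpha, beta) to the integral Heisenberg
   group, whose elements are the unitriangular 3x3 integer matrices. *)
Lemma free_heisenberg_lift (X : choiceType) (alpha beta : free_group X -> int) :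
  additive_on_group alpha -> additive_on_group beta ->
  exists gamma : free_group X -> int, forall x y,
    gamma (x * y) = (gamma x + gamma y + alpha x * beta y)%R.
Proof.
move=> aM bM; pose cl := @pres_class X (fun _ _ => False).
(* Generators lift with corner entry 0. The inverse of the unitriangular matrix with entries
   [alpha], 0, [beta] has corner entry the product of [alpha] and [beta]. *)
pose c (l : X * bool) : int :=
  if l.2 then 0%R else (alpha (gen _ l.1) * beta (gen _ l.1))%R.
(* The second component carries the word itself, because the corner entry of a product involves
   [beta] of the tail. *)
pose gw (w : word X) := foldr
  (fun l (p : int * word X) =>
     ((c l + p.1 + alpha (cl [:: l]) * beta (cl p.2))%R, l :: p.2))
  (0%R, [::]) w.
have gw2 w : (gw w).2 = w by elim: w => //= l w ->.
have gwD u v :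
    (gw (u ++ v)).1 = ((gw u).1 + (gw v).1 + alpha (cl u) * beta (cl v))%R.
  elim: u => [|l u IH]; first by rewrite /cl pres_class0 (add1 aM) /=; ring.
  rewrite /= !gw2 IH -(cat1s l u) /cl !pres_classM !aM !bM.
  ring.
have gwP u v : pres_eq (fun _ _ => False) u v -> (gw u).1 = (gw v).1.
  elim=> {u v} [//|u v _ IH|u v w _ IH1 _ IH2|p q x b|//].
  - by rewrite IH.
  - by rewrite IH1 IH2.
  rewrite catA gwD (gwD p q) gwD.
  have -> : cl (p ++ [:: (x, b); (x, ~~ b)]) = cl p.
    apply/pres_classP; have := pres_cancel (fun _ _ => False) p [::] x b.
    by rewrite /= cats0.
  have -> : cl [:: (x, b); (x, ~~ b)] = 1.
    by apply/pres_classP; have := pres_cancel (fun _ _ => False) [::] [::] x b.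
  rewrite (add1 bM) /= /c /cl pres_class0 (add1 bM).
  by case: b; rewrite /= pres_class_genV !(addV aM, addV bM) /gen; ring.
exists (fun g => (gw (repr g)).1) => x y.
transitivity (gw (repr x ++ repr y)).1; last by rewrite gwD /cl !repr_classK.
apply/gwP/(pres_classP _ _ _).
by rewrite pres_classM !repr_classK.
Qed.

(** The corner entries of the lifts of [x * y] and [y * x] differ by exactly this determinant. *)
Lemma free_commute_det (X : choiceType) (alpha beta : free_group X -> int) x y :
  additive_on_group alpha -> additive_on_group beta -> commute x y ->
  (alpha x * beta y = alpha y * beta x)%R.
Proof.
move=> aM bM cxy; have [gamma gM] := free_heisenberg_lift aM bM.
by have := gM y x; rewrite -cxy gM; lia.
Qed.

(** * Normal forms in free groups *)

Section NormalForm.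
Variable X : choiceType.

Definition reduced_cons (l : X * bool) (w : word X) :=
  if w isn't l' :: _ then true else l' != (l.1, ~~ l.2).

Fixpoint reduced (w : word X) :=
  if w is l :: w' then reduced_cons l w' && reduced w' else true.

Definition red_step (l : X * bool) (w : word X) :=
  if reduced_cons l w then l :: w else behead w.

Lemma reduced_behead w : reduced w -> reduced (behead w).
Proof. by case: w => //= l w /andP[]. Qed.

Lemma red_step_reduced l w : reduced w -> reduced (red_step l w).
Proof.
by move=> rw; rewrite /red_step; case: ifP => /= [->//|_]; exact: reduced_behead.
Qed.

Definition reduced_word := {w : word X | reduced w}.

(** Van der Waerden's device: letters permute the reduced words, so the normal form depends only on
    the group element and no confluence argument is needed. *)
Definition red_act (l : X * bool) (r : reduced_word) : reduced_word :=
  exist _ (red_step l (sval r)) (red_step_reduced l (svalP r)).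

Lemma red_actK x b r : red_act (x, b) (red_act (x, ~~ b) r) = r.
Proof.
apply: val_inj; case: r => /= -[|[y c] w] //=.
  by rewrite /red_step /= eqxx.
move=> /andP[ryw rw]; rewrite {2}/red_step /= negbK.
have [[<- <-]|ne] := eqVneq (y, c) (x, b); last first.
  by rewrite /red_step /= eqxx.
by rewrite /red_step ryw.
Qed.

Definition red_word (w : word X) (r : reduced_word) := word_act red_act w r.

Lemma red_word_pres u v : pres_eq (fun _ _ => False) u v ->
  red_word u =1 red_word v.
Proof. by move=> uv; apply: (word_act_pres red_actK _ uv) => u' v' t []. Qed.

Definition empty_reduced : reduced_word := exist _ [::] isT.

Definition normal_form (w : word X) : word X := sval (red_word w empty_reduced).

Lemma normal_form_reduced w : reduced (normal_form w).
Proof. exact: (svalP (red_word w empty_reduced)). Qed.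

Lemma red_word_val (w : word X) r : reduced (w ++ sval r) ->
  sval (red_word w r) = w ++ sval r.
Proof.
elim: w => //= l w IH /andP[rl rw].
by rewrite IH // /red_step rl.
Qed.

Lemma red_wordVpres (w : word X) r :
  pres_eq (fun _ _ => False) (sval (red_word w r)) (w ++ sval r).
Proof.
elim: w => [|[x b] w IH] /=; first exact: pres_refl.
apply: (pres_trans (v := (x, b) :: sval (red_word w r))); last first.
  exact: (pres_cat (pres_refl _ [:: (x, b)]) IH).
rewrite -/(red_word w r) /red_step; case: ifPn => rc; first exact: pres_refl.
case: (sval _) rc => [|[y c] s] //=; rewrite negbK => /eqP[-> ->].
exact/pres_sym/(pres_cancel _ [::] s).
Qed.

Lemma normal_form_pres w : pres_eq (fun _ _ => False) (normal_form w) w.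
Proof. by have := red_wordVpres w empty_reduced; rewrite cats0. Qed.

(** Every cancellation makes the result strictly shorter, so equal lengths rule out cancellation. *)
Lemma red_word_size (w : word X) r :
  sval (red_word w r) = w ++ sval r \/
  size (sval (red_word w r)) < size w + size (sval r).
Proof.
elim: w => [|l w IH] /=; first by left.
rewrite -/(red_word w r) /red_step; case: ifP => _ /=; last first.
  by right; rewrite size_behead; case: IH => [->|]; rewrite ?size_cat; lia.
by case: IH => [->|]; [left | right; lia].
Qed.

Lemma reduced_nseq n (l : X * bool) w :
  reduced w -> reduced_cons l w -> reduced (nseq n l ++ w).
Proof.
move=> rw lw; elim: n => //= n ->; rewrite andbT; case: n => //= _.
by case: l {lw} => x b; rewrite xpair_eqE eqxx; case: b.
Qed.

(* If [r ++ x^i] and [x^i ++ r] reduce to the same word and the latter is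
   reduced, nothing cancels, so that [r] starts with [x]. *)
Lemma commute_power_head (x : X) i (r : word X) :
  0 < i -> reduced r ->
  pres_eq (fun _ _ => False) (r ++ nseq i (x, true)) (nseq i (x, true) ++ r) ->
  r = [::] \/ exists b s, r = (x, b) :: s.
Proof.
move=> i0 rr e; case: r rr e => [|[y b] s] rr e; [by left | right].
have [->|nyx] := eqVneq y x; first by exists b, s.
have rx : reduced (nseq i (x, true) ++ (y, b) :: s).
  by apply: reduced_nseq => //=; rewrite xpair_eqE (negbTE nyx).
have rx0 : reduced (nseq i (x, true)).
  by rewrite -[nseq _ _]cats0; apply: reduced_nseq.
have := red_word_pres e empty_reduced.
rewrite /red_word word_act_cat => /(congr1 sval).
rewrite -!/(red_word _ _) (@red_word_val (nseq i _ ++ _)) ?cats0 //.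
case: (@red_word_size ((y, b) :: s) (red_word (nseq i (x, true)) empty_reduced)).
  move=> -> /=; case: i i0 {e rx rx0} => //= i _ [yx].
  by rewrite yx eqxx in nyx.
rewrite [sval (red_word (nseq _ _) _)]red_word_val ?cats0 // => lt eqs.
by move: lt; rewrite eqs !size_cat size_nseq /=; lia.
Qed.

Lemma pres_class_nseq (R : word X -> word X -> Prop) n (x : X) :
  pres_class R (nseq n (x, true)) = gen R x ^+ n.
Proof. by elim: n => // n IH; rewrite expgS /= -cat1s pres_classM IH. Qed.

(** A nonempty normal form of [z] would have to begin with a letter of [x] and also with a letter of
    [y]. *)
Lemma free_centralizer (x y : X) i j (z : free_group X) :
  x != y -> 0 < i -> 0 < j ->
  commute z (gen _ x ^+ i) -> commute z (gen _ y ^+ j) -> z = 1.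
Proof.
move=> nxy i0 j0 cx cy.
pose r := normal_form (repr z).
have rz : pres_class _ r = z.
  by rewrite -[RHS]repr_classK; apply/pres_classP/normal_form_pres.
suff r0 : r = [::] by rewrite -rz r0.
have key t k : 0 < k -> commute z (gen _ t ^+ k) ->
    r = [::] \/ exists b s, r = (t, b) :: s.
  move=> k0 ct; apply: (commute_power_head k0 (normal_form_reduced _)).
  by apply/pres_classP; rewrite !pres_classM pres_class_nseq rz.
have [//|[b [s rE]]] := key x i i0 cx.
have [//|[c [t rE']]] := key y j j0 cy.
by move: rE; rewrite rE' => -[yx]; rewrite yx eqxx in nxy.
Qed.
End NormalForm.

Lemma free_rank_one (X : choiceType) (x : X) (g : free_group X) :
  (forall y : X, y = x) -> exists i j, g = gen _ x ^+ i / gen _ x ^+ j.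
Proof.
move=> xE; move: g; apply: gen_ind => [||g h [i [j ->]] [k [l ->]]|g [i [j ->]]].
- by exists 0, 0; rewrite expg0 mulgV.
- by move=> y; exists 1%N, 0; rewrite (xE y) expg0 divg1.
- exists (i + k), (j + l); rewrite !expgnDr invgM -!mulgA; congr (_ * _).
  set u := gen _ x; have c a b : commute (u ^+ a) (u ^+ b) by exact: commuteX2.
  rewrite [RHS]mulgA; apply/esym/commuteV.
  by apply/commute_sym/commuteM; [exact: c | exact/commuteV/c].
- by exists j, i; rewrite invgM invgK.
Qed.

(** * Towers *)

Lemma subgroup_pred (G : groupType) (P : G -> Prop) :
  P 1 -> (forall x y, P x -> P y -> P (x * y)) -> (forall x, P x -> P x^-1) ->
  exists H : groupClosed G, forall x, (x \in H) = `[< P x >].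
Proof.
move=> P1 PM PV; pose S : {pred G} := fun x : G => `[< P x >].
have S1 : 1 \in S by apply/asboolP.
have SM : mulg_closed S by move=> x y /asboolP Px /asboolP Py; apply/asboolP/PM.
have SV : invg_closed S by move=> x /asboolP Px; apply/asboolP/PV.
pose H := HB.pack_for (groupClosed G) S
  (isMulClosed.Build G S SM) (isMul1Closed.Build G S S1) (isInvClosed.Build G S SV).
by exists H.
Qed.

Lemma inj_surj_bij (A B : Type) (f : A -> B) :
  injective f -> (forall y, exists x, f x = y) -> bijective f.
Proof.
move=> inj_f surj_f; exists (fun y => sval (cid (surj_f y))) => [x|y].
  by apply: inj_f; case: cid.
by case: cid.
Qed.

Lemma pres_eq_map (X Y : choiceType) (f : X -> Y) (u v : word X) :
  pres_eq (fun _ _ => False) u v ->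
  pres_eq (fun _ _ => False) [seq (f l.1, l.2) | l <- u] [seq (f l.1, l.2) | l <- v].
Proof.
elim=> {u v} [u|u v _ IH|u v w _ IH1 _ IH2|p q x b|//].
- exact: pres_refl.
- exact: pres_sym.
- exact: pres_trans IH1 IH2.
- by rewrite !map_cat /=; apply: pres_cancel.
Qed.

Section TowerStep.
Variables (G : groupType) (H K : groupClosed G) (nHK : normal_in H K).

(** Trades the quotient type, which depends on a proof, for a map on the ambient group. Outside [K]
    the map built here takes the default value 1, so multiplicativity is claimed only on [K]. *)
Lemma quotient_fg_freeP : fg_free (quotient_group nHK) ->
  exists n, exists2 rho : G -> free_group 'I_n,
    {in K &, {morph rho : x y / x * y}} &
    (forall w, exists2 g, g \in K & rho g = w) /\
    (forall g, g \in K -> rho g = 1 <-> g \in H).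
Proof.
case=> n [f [f' fK f'K]]; exists n.
have fM x y : f (x * y) = f x * f y by exact: gmulfM.
have f'M : {morph f' : x y / x * y}.
  by move=> x y; rewrite -{1}(f'K x) -{1}(f'K y) -fM fK.
pose rho g := if @idP (g \in K) is ReflectT gK
  then f' (coset_class nHK (exist _ g gK)) else 1.
have rhoE g (gK : g \in K) : rho g = f' (coset_class nHK (exist _ g gK)).
  rewrite /rho; case: {-}_ / idP => // gK'.
  by rewrite (bool_irrelevance gK gK').
exists rho => [x y xK yK|].
  rewrite (rhoE _ (gpredM _ _ xK yK)) (rhoE _ xK) (rhoE _ yK) -f'M.
  congr f'; rewrite [RHS]quotient_mulE; congr coset_class; exact: val_inj.
split=> [w|g gK].
  exists (val (coset_repr (f w))); first exact: valP.
  rewrite (rhoE _ (valP _)); rewrite -[RHS]fK; congr f'.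
  rewrite -[RHS]coset_reprK; congr coset_class; exact: val_inj.
have -> : g \in H <-> coset_class nHK (exist _ g gK) = 1.
  rewrite -[1](coset_reprK (1 : quotient_group nHK)).
  have -> : coset_class nHK (coset_repr (1 : quotient_group nHK)) =
      coset_class nHK 1 by rewrite coset_reprK.
  by rewrite coset_classP /coset_rel /= mulg1 gpredV.
rewrite rhoE; split=> [e|->].
  by rewrite -[LHS]f'K e; apply: morph_one fM.
exact: morph_one f'M.
Qed.

(** Allows a basis indexed by any finite type. [fg_free] asks for ordinals, so [Y] is enumerated by
    the mutually inverse maps [idx] and [nt]. *)
Lemma fg_free_criterion (Y : choiceType) (phi : Y -> G) :
  finite_set [set: Y] -> (forall y, phi y \in K) ->
  (forall g, g \in K -> exists w : word Y, (word_eval phi w)^-1 * g \in H) ->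
  (forall w : word Y, word_eval phi w \in H -> pres_eq (fun _ _ => False) w [::]) ->
  fg_free (quotient_group nHK).
Proof.
move=> finY phiK gen_phi free_phi.
have [s0 sE] := (finite_seqP _).1 finY.
pose s := undup s0.
have sP y : y \in s.
  by rewrite mem_undup; have : [set: Y]%classic y by []; rewrite sE.
have idxP y : index y s < size s by rewrite index_mem.
pose idx y : 'I_(size s) := Ordinal (idxP y).
pose nt : 'I_(size s) -> Y := tnth (in_tuple s).
have ntK : cancel nt idx.
  move=> i; apply: val_inj; rewrite /= /nt (tnth_nth (nt i)) /=.
  by rewrite index_uniq // undup_uniq.
have idxK : cancel idx nt.
  by move=> y; rewrite /nt (tnth_nth y) /= nth_index.
pose phi' i : subgroup_type K := exist _ (phi (nt i)) (phiK (nt i)).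
pose h i := coset_class nHK (phi' i).
have clM : {morph coset_class nHK : x y / x * y}.
  by move=> x y; rewrite [RHS]quotient_mulE.
have cl1 (x : subgroup_type K) : coset_class nHK x = 1 <-> val x \in H.
  by rewrite -(morph_one clM) coset_classP /coset_rel mulg1 gpredV.
have valE w : val (word_eval phi' w) = word_eval phi [seq (nt l.1, l.2) | l <- w].
  rewrite (morph_word_eval (f := val)); last exact: valM.
  by elim: w => //= l w ->.
have hE w : word_eval h w = coset_class nHK (word_eval phi' w).
  by rewrite (morph_word_eval clM).
have hR u v : False -> word_eval h u = word_eval h v by [].
pose f : free_group 'I_(size s) -> quotient_group nHK := pres_lift h.
have fM : {morph f : x y / x * y} by exact: pres_liftM.
have fE w : f (pres_class _ w) = word_eval h w by exact: pres_lift_class.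
pose F : {multiplicative free_group 'I_(size s) -> quotient_group nHK} :=
  HB.pack_for {multiplicative free_group 'I_(size s) -> quotient_group nHK} f
    (isMultiplicative.Build _ _ f fM).
exists (size s), F; apply: inj_surj_bij => [x y|y].
  change (f x = f y -> x = y) => exy.
  suff : x / y = 1 by exact: divg1_eq.
  have : f (x / y) = 1 by rewrite fM (morph_inv fM) exy mulgV.
  move: (x / y); apply: pres_ind => w; rewrite fE hE => /cl1.
  rewrite valE => /free_phi /(pres_eq_map idx).
  rewrite -map_comp (eq_map (g := id)) ?map_id => [e|[i b] /=]; last by rewrite ntK.
  exact/pres_classP.
have [w wH] := gen_phi _ (valP (coset_repr y)).
exists (pres_class _ [seq (idx l.1, l.2) | l <- w]).
change (f (pres_class (fun _ _ => False) [seq (idx l.1, l.2) | l <- w]) = y).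
rewrite fE hE -[RHS]coset_reprK; apply/coset_classP.
rewrite /coset_rel valE -map_comp (eq_map (g := id)) ?map_id // => -[i b] /=.
by rewrite idxK.
Qed.
End TowerStep.

(* The tower 1 <| ker rho <| G. *)
Lemma tower2_of_retraction (G : groupType) (Y Z : choiceType)
    (rho : G -> free_group Y) (phi : Y -> G) (psi : Z -> G) :
  finite_set [set: Y] -> finite_set [set: Z] ->
  {morph rho : x y / x * y} -> (forall y, rho (phi y) = gen _ y) ->
  (forall z, rho (psi z) = 1) ->
  (forall g, rho g = 1 -> exists w, g = word_eval psi w) ->
  (forall w, word_eval psi w = 1 -> pres_eq (fun _ _ => False) w [::]) ->
  poly_fg_free_tower G 2.
Proof.
move=> finY finZ rhoM rho_phi rho_psi gen_psi free_psi.
have [|||T0 T0E] := @subgroup_pred G (fun g => g = 1).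
- by [].
- by move=> x y -> ->; rewrite mulg1.
- by move=> x ->; rewrite invg1.
have [|||T1 T1E] := @subgroup_pred G (fun g => rho g = 1).
- exact: morph_one.
- by move=> x y ex ey; rewrite rhoM ex ey mulg1.
- by move=> x ex; rewrite morph_inv // ex invg1.
have [|||T2 T2E] := @subgroup_pred G (fun=> True) => //.
have n01 : normal_in T0 T1.
  split=> [x|x y]; rewrite !T0E => /asboolP->.
    by rewrite T1E; apply/asboolP/morph_one.
  by move=> _; apply/asboolP; rewrite conj1g.
have n12 : normal_in T1 T2.
  split=> [x _|x y]; first by rewrite T2E; apply/asboolP.
  rewrite !T1E => /asboolP ex _; apply/asboolP.
  by rewrite /conjg !rhoM morph_inv // ex mul1g mulVg.
exists (fun i => if i is i'.+1 then if i' is _.+1 then T2 else T1 else T0); split.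
- by move=> x; rewrite T0E; apply/asboolP/eqP.
- by move=> x; rewrite T2E; apply/asboolP.
case=> [_|[_|//]]; [exists n01 | exists n12].
- apply: (@fg_free_criterion _ _ _ _ _ psi) => //.
  + by move=> z; rewrite T1E; apply/asboolP.
  + move=> g; rewrite T1E => /asboolP/gen_psi[w ->].
    by exists w; rewrite T0E mulVg; apply/asboolP.
  + by move=> w; rewrite T0E => /asboolP; apply: free_psi.
have rho_eval w : rho (word_eval phi w) = pres_class _ w.
  by rewrite morph_word_eval // (eq_word_eval rho_phi) word_eval_gen.
apply: (@fg_free_criterion _ _ _ _ _ phi) => //.
- by move=> y; rewrite T2E; apply/asboolP.
- move=> g _; exists (repr (rho g)); rewrite T1E; apply/asboolP.
  by rewrite rhoM morph_inv // rho_eval repr_classK mulVg.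
- move=> w; rewrite T1E => /asboolP; rewrite rho_eval => e.
  exact/pres_classP.
Qed.

Lemma tower1_of_basis (G : groupType) (Y : choiceType) (phi : Y -> G) :
  finite_set [set: Y] ->
  (forall g, exists w, g = word_eval phi w) ->
  (forall w, word_eval phi w = 1 -> pres_eq (fun _ _ => False) w [::]) ->
  poly_fg_free_tower G 1.
Proof.
move=> finY gen_phi free_phi.
have [|||T0 T0E] := @subgroup_pred G (fun g => g = 1).
- by [].
- by move=> x y -> ->; rewrite mulg1.
- by move=> x ->; rewrite invg1.
have [|||T1 T1E] := @subgroup_pred G (fun=> True) => //.
have n01 : normal_in T0 T1.
  split=> [x|x y]; rewrite !T0E => /asboolP->; first by rewrite T1E; apply/asboolP.
  by move=> _; apply/asboolP; rewrite conj1g.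
exists (fun i => if i is _.+1 then T1 else T0); split.
- by move=> x; rewrite T0E; apply/asboolP/eqP.
- by move=> x; rewrite T1E; apply/asboolP.
case=> [_|//]; exists n01; apply: (@fg_free_criterion _ _ _ _ _ phi) => //.
- by move=> z; rewrite T1E; apply/asboolP.
- move=> g _; have [w ->] := gen_phi g.
  by exists w; rewrite T0E mulVg; apply/asboolP.
- by move=> w; rewrite T0E => /asboolP; apply: free_phi.
Qed.

Lemma tower1_free (G : groupType) : poly_fg_free_tower G 1 ->
  exists n (rho : G -> free_group 'I_n),
    [/\ {morph rho : x y / x * y}, forall w, exists g, rho g = w
      & forall g, rho g = 1 -> g = 1].
Proof.
case=> T [T0 T1 /(_ 0 isT)[nT /quotient_fg_freeP[n [rho rhoM [rhoS rho1]]]]].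
exists n, rho; split=> [x y|w|g e]; first by rewrite rhoM.
  by have [g _ <-] := rhoS w; exists g.
by apply/eqP; rewrite -T0 -rho1.
Qed.

(** Lifting a basis of the bottom quotient gives [iota], with left inverse [rho0]. If one of the
    ranks were 0, that step of the tower would be trivial, and dropping it would leave a tower of
    length 1. *)
Lemma length2_extension (G : groupType) : poly_fg_free_of_length G 2 ->
  exists m n (iota : free_group 'I_m -> G) (rho : G -> free_group 'I_n),
    [/\ {morph iota : x y / x * y}, injective iota, {morph rho : x y / x * y},
        (forall w, exists g, rho g = w) /\
        (forall g, rho g = 1 <-> exists w, g = iota w)
      & 0 < m /\ 0 < n].
Proof.
case=> -[T [T0 T2 Tstep]] minG.
have [nT0 /[dup] free0 /quotient_fg_freeP[m [rho0 rho0M [rho0S rho0K]]]] := Tstep 0 isT.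
have [nT1 /[dup] free1 /quotient_fg_freeP[n [rho rhoM [rhoS rhoK]]]] := Tstep 1%N isT.
have /choice[li liP] (i : 'I_m) : exists g, g \in T 1%N /\ rho0 g = gen _ i.
  by have [g gT gE] := rho0S (gen _ i); exists g.
pose iota : free_group 'I_m -> G := pres_lift li.
have iotaM : {morph iota : x y / x * y} by exact: pres_liftM.
have iotaT w : iota w \in T 1%N.
  move: w; apply: gen_ind.
  - by rewrite (morph_one iotaM) gpred1.
  - by move=> i; rewrite /iota pres_lift_gen //; case: (liP i).
  - by move=> g h gT hT; rewrite iotaM gpredM.
  - by move=> g gT; rewrite (morph_inv iotaM) gpredV.
have iotaK : cancel iota rho0.
  apply: (@morph_gen_eq _ _ _ (rho0 \o iota) id) => [x y|//|i].
    by rewrite /comp iotaM rho0M.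
  by rewrite /comp /iota pres_lift_gen //; case: (liP i).
have rho0F g h : g \in T 1%N -> h \in T 1%N -> rho0 g = rho0 h -> g = h.
  move=> gT hT e; apply: divg1_eq; apply/eqP; rewrite -T0 -rho0K ?gpredF //.
  have e1 : rho0 1 = 1 by apply/rho0K; rewrite ?gpred1.
  apply: (mulIg (rho0 h)); rewrite -rho0M ?gpredF // mulgVK mul1g //.
exists m, n, iota, rho; split=> //.
- exact: can_inj iotaK.
- by move=> x y; rewrite rhoM.
- split=> [w|g]; first by have [g _ <-] := rhoS w; exists g.
  rewrite rhoK //; split=> [gT|[w ->]]; last exact: iotaT.
  by exists (rho0 g); apply: rho0F; rewrite ?iotaT ?iotaK.
have triv k (w : free_group 'I_k) : k = 0 -> w = 1.
  move=> k0; move: w; apply: pres_ind; case=> // -[[i lti]] b w.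
  by exfalso; rewrite k0 in lti.
split; rewrite lt0n; apply/eqP => z0.
- suff : poly_fg_free_tower G 1 by move/minG.
  exists (fun i => T i.+1); split=> // [x|[_|//]]; last exact: Tstep.
  apply/idP/eqP => [xT|->]; last exact: gpred1.
  by apply: rho0F; rewrite ?gpred1 // (triv _ (rho0 x)) // (triv _ (rho0 1)).
- suff : poly_fg_free_tower G 1 by move/minG.
  exists T; split=> // [x|[_|//]]; last exact: Tstep.
  by apply/rhoK => //; apply: triv.
Qed.

(** * Derivations into permutation modules *)

Section FiniteIndex.
Variables (G : groupType) (K : G -> Prop).
Hypotheses (K1 : K 1) (KM : forall x y, K x -> K y -> K (x * y))
  (KV : forall x, K x -> K x^-1).

(** A list of pairs (g, k) encodes the element of Z[G/K] that is the sum of the k gK; this is its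
    coefficient at the coset qK. *)
Definition coset_sum (L : seq (G * int)) (q : G) : int :=
  \sum_(l <- L | `[< K (l.1^-1 * q) >]) l.2.

Lemma coset_eqKl x y z : K (x^-1 * y) -> K (x^-1 * z) <-> K (y^-1 * z).
Proof.
move=> Kxy; split=> Kz.
  by have := KM (KV Kxy) Kz; rewrite invgM invgK -mulgA mulVKg.
by have := KM Kxy Kz; rewrite -mulgA mulVKg.
Qed.

(** The zero element has augmentation 0 whichever list encodes it: the terms in the coset of the
    first entry add up to 0, and the shorter list of the other terms still encodes zero. *)
Lemma coset_sum_eq0 L :
  (forall q, coset_sum L q = 0%R) -> (\sum_(l <- L) l.2 = 0)%R.
Proof.
have [n] := ubnP (size L); elim: n L => // n IH [|l0 L] ltn L0.
  by rewrite big_nil.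
rewrite (bigID (fun l => `[< K (l.1^-1 * l0.1) >])) /=.
rewrite [X in (X + _)%R](L0 l0.1) add0r -big_filter.
apply: IH => [|q].
  rewrite /= mulVg (asboolT K1) /= size_filter.
  by apply: leq_ltn_trans (count_size _ _) _.
rewrite /coset_sum big_filter_cond.
have [Kq|nKq] := pselect (K (l0.1^-1 * q)).
  apply: big1 => l /andP[/asboolPn nK /asboolP Kl]; case: nK.
  by have := KM Kl (KV Kq); rewrite invgM invgK mulgA mulgK.
rewrite -[RHS](L0 q); apply: eq_bigl => l; rewrite andbC.
case: asboolP => //= Kl; apply/asboolPn => Kl0; apply: nKq.
exact/(coset_eqKl _ Kl0).
Qed.

(** Pigeonhole: among the powers of [g] with exponents from 0 to [size s], two lie in the same
    coset. *)
Lemma finite_cosets_power (s : seq G) :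
  (forall h, exists2 p, p \in s & K (p^-1 * h)) ->
  forall g, exists2 i, 0 < i & K (g ^+ i).
Proof.
move=> sK g.
have /choice[c cP] (k : 'I_(size s).+1) :
    exists i : 'I_(size s), K ((tnth (in_tuple s) i)^-1 * g ^+ k).
  have [p /(nthP 1)[i lti <-] Kp] := sK (g ^+ k).
  by exists (Ordinal lti); rewrite (tnth_nth 1).
have /injectivePn[a [b nab eab]] : ~~ injectiveb c.
  by apply/injectiveP => /leq_card; rewrite !card_ord ltnn.
wlog ltab : a b nab eab / a < b.
  have : val a != val b by [].
  rewrite neq_ltn => /orP[lt|lt] H; first exact: H lt.
  by apply: H lt; rewrite 1?eq_sym.
exists (b - a); first by rewrite subn_gt0.
have := KM (KV (cP a)) (cP b); rewrite eab invgM invgK -mulgA mulVKg.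
by rewrite -{1}(subnKC (ltnW ltab)) expgnDr mulKg.
Qed.

(** Here [f g] is a function on [G], and [h] acts on such functions from the right by precomposition
    with left multiplication by [h]. The identity below says that [f] is a derivation for this
    action. *)
Variable f : G -> G -> int.
Hypothesis fM : forall g h q, f (g * h) q = (f g (h * q) + f h q)%R.

Lemma cocycle1 q : f 1 q = 0%R.
Proof. by have := fM 1 1 q; rewrite !mul1g; lia. Qed.

Lemma cocycleV g q : f g^-1 q = (- f g (g^-1 * q))%R.
Proof.
have := fM g g^-1 q; rewrite mulgV cocycle1 => /esym/eqP.
by rewrite addrC addr_eq0 => /eqP.
Qed.

(** The function [f g] is an element of Z[G/K], and its augmentation is [sigma g]. *)
Definition sum_of_cosets (sigma : G -> int) (g : G) := exists L : seq (G * int),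
  (forall q, f g q = coset_sum L q) /\ sigma g = (\sum_(l <- L) l.2)%R.

Lemma coset_sum_translate L g q :
  coset_sum [seq (g^-1 * l.1, l.2) | l <- L] q = coset_sum L (g * q).
Proof.
by rewrite /coset_sum big_map; apply: eq_bigl => l; rewrite /= invgM invgK mulgA.
Qed.

Lemma sum_of_cosetsM sigma g h : additive_on_group sigma ->
  sum_of_cosets sigma g -> sum_of_cosets sigma h -> sum_of_cosets sigma (g * h).
Proof.
move=> sM [L [fL sL]] [L' [fL' sL']].
exists ([seq (h^-1 * l.1, l.2) | l <- L] ++ L'); split=> [q|].
  by rewrite /coset_sum big_cat -!/(coset_sum _ _) coset_sum_translate fM fL fL'.
by rewrite sM sL sL' big_cat big_map.
Qed.

Lemma sum_of_cosetsV sigma g : additive_on_group sigma ->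
  sum_of_cosets sigma g -> sum_of_cosets sigma g^-1.
Proof.
move=> sM [L [fL sL]].
exists [seq (l.1, - l.2)%R | l <- [seq (g^-1^-1 * l.1, l.2) | l <- L]].
split=> [q|].
  rewrite cocycleV fL /coset_sum !big_map sumrN; congr (- _)%R.
  by apply: eq_bigl => l /=; rewrite !(invgM, invgK) mulgA.
by rewrite (addV sM) sL !big_map sumrN.
Qed.

Lemma sum_of_cosets1 sigma : additive_on_group sigma -> sum_of_cosets sigma 1.
Proof.
move=> sM; exists [::]; rewrite /coset_sum; split=> [q|].
  by rewrite cocycle1 big_nil.
by rewrite (add1 sM) big_nil.
Qed.

Hypothesis f_cosets : forall g, exists sigma, sum_of_cosets sigma g.

Lemma cocycle_supp g : exists s : seq G,
  forall q, f g q != 0%R -> exists2 p, p \in s & K (p^-1 * q).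
Proof.
have [_ [L [fL _]]] := f_cosets g; exists (unzip1 L) => q.
rewrite fL; apply: contraNP => nK; apply/eqP.
rewrite /coset_sum big_seq_cond big1 // => l /andP[lL /asboolP Kl].
by case: nK; exists l.1; first exact: map_f.
Qed.

Lemma cocycle_rinv g q k : K k -> f g (q * k) = f g q.
Proof.
move=> Kk; have [_ [L [fL _]]] := f_cosets g; rewrite !fL.
apply: eq_bigl => l; apply/asboolP/asboolP; rewrite mulgA => Kl.
  by have := KM Kl (KV Kk); rewrite mulgK.
exact: KM.
Qed.

(* The values of the cocycle on the finitely generated normal subgroup N have
   supports in a common finite set of cosets, and the union of these supports
   is invariant under left translations. *)
Lemma cocycle_finite_index (X : finType) (iota : free_group X -> G) :
  {morph iota : x y / x * y} ->
  (forall w g, exists w', iota w ^ g = iota w') ->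
  (forall w, K (iota w)) ->
  (exists w q, f (iota w) q != 0%R) ->
  forall g, exists2 i, 0 < i & K (g ^+ i).
Proof.
move=> iotaM iotaJ iotaK [w [q fwq]].
(* N is normal and contained in [K], so left translation by N fixes every coset of [K]. *)
have fN g w' q' : f g (iota w' * q') = f g q'.
  have [w2 w2E] := iotaJ w' q'.
  by rewrite conjgC w2E cocycle_rinv.
have /choice[s sP] (x : X) := cocycle_supp (iota (gen _ x)).
apply: (@finite_cosets_power (flatten [seq s x | x <- enum X])) => h.
have suppN w' q' : f (iota w') q' != 0%R ->
    exists2 p, p \in flatten [seq s x | x <- enum X] & K (p^-1 * q').
  move: w' q'; apply: gen_ind.
  - by move=> q'; rewrite (morph_one iotaM) cocycle1.
  - move=> x q' /sP[p ps Kp]; exists p => //.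
    by apply/flatten_mapP; exists x; rewrite ?mem_enum.
  - move=> w1 w2 IH1 IH2 q'; rewrite iotaM fM fN => ne.
    have [e1|/IH1//] := eqVneq (f (iota w1) q') 0%R.
    by apply: IH2; move: ne; rewrite e1 add0r.
  - move=> w1 IH q'; rewrite (morph_inv iotaM) cocycleV oppr_eq0.
    by rewrite -(morph_inv iotaM) fN => /IH.
(* Conjugation by [h * q^-1] moves the nonzero value at [q] to the given [h], so that [h] lies in
   the common support. *)
have [w' w'E] := iotaJ w (h * q^-1)^-1.
have [p ps Kp] : exists2 p, p \in flatten [seq s x | x <- enum X] & K (p^-1 * h).
  apply: (suppN w'); rewrite -w'E /conjg invgK.
  set c := h * q^-1; have hE : h = c * q by rewrite /c mulgVK.
  rewrite hE mulgA fM fM mulKg fN.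
  have /esym/eqP := fM c^-1 c q; rewrite mulVg cocycle1 addr_eq0 => /eqP->.
  by rewrite addrAC subrr add0r.
by exists p.
Qed.
End FiniteIndex.

(** * Derivations on right-angled Artin groups *)

Section RaagCocycle.
Variable Gam : simple_graph.
Notation G := (raag Gam).
Notation vgen := (gen (@raag_rel Gam)).

Lemma raag_gen_commute (u v : Gam) : adj u v -> commute (vgen u) (vgen v).
Proof.
move=> auv; rewrite /commute -!pres_classM; apply/pres_classP.
exact: (pres_rel [::] [::] (RaagRel auv)).
Qed.

Lemma raag_rel_word_sum (h : Gam -> int) u v :
  raag_rel u v -> word_sum h u = word_sum h v.
Proof. by case=> x y _; rewrite /= /letter_sum /=; lia. Qed.

Lemma raag_rel_word_eval (H : groupType) (h : Gam -> H) :
  (forall u v, adj u v -> commute (h u) (h v)) ->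
  forall u v, raag_rel u v -> word_eval h u = word_eval h v.
Proof.
by move=> hC _ _ [x y /hC axy]; rewrite /= !mulg1 /eval_letter.
Qed.

Definition vexp (v : Gam) : G -> int := exp_sum (fun x => Posz (x == v)).

Lemma vexpM v : additive_on_group (vexp v).
Proof. exact/exp_sumM/raag_rel_word_sum. Qed.

Lemma vexp_gen v u : vexp v (vgen u) = Posz (u == v).
Proof. exact/exp_sum_gen/raag_rel_word_sum. Qed.

(** A derivation amounts to a lift of left multiplication to pairs (q, k), where [g] adds [f g q] to
    k. The hypothesis says that the lifts of adjacent vertices commute. *)
Lemma raag_cocycle (phi : Gam -> G -> int) :
  (forall u v q, adj u v ->
     (phi u (vgen v * q)%g + phi v q = phi v (vgen u * q)%g + phi u q)%R) ->
  exists2 f : G -> G -> int,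
    forall g h q, f (g * h) q = (f g (h * q)%g + f h q)%R &
    forall v q, f (vgen v) q = phi v q.
Proof.
move=> phiC.
pose a (l : Gam * bool) (t : G * int) := if l.2
  then (vgen l.1 * t.1, (t.2 + phi l.1 t.1)%R)
  else ((vgen l.1)^-1 * t.1, (t.2 - phi l.1 ((vgen l.1)^-1 * t.1)%g)%R).
have aE w q k : word_act a w (q, k) =
    (pres_class _ w * q, (k + (word_act a w (q, 0%R)).2)%R).
  elim: w k => [|[x b] w IH] k /=; first by rewrite pres_class0 mul1g addr0.
  rewrite -/(word_act a w (q, k)) -/(word_act a w (q, 0%R)) IH (IH 0%R).
  rewrite -cat1s pres_classM /a; case: b => /=; rewrite ?pres_class_genV.
    by rewrite mulgA !add0r addrA.
  by rewrite !mulgA !add0r addrA.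
have aP u v : pres_eq (@raag_rel Gam) u v -> word_act a u =1 word_act a v.
  apply: word_act_pres => [x b [q k]|_ _ [q k] [x y axy]].
    by case: b; rewrite /a /= ?mulVKg ?mulKg; congr (_, _); lia.
  rewrite /a /=; congr (_, _); last by have := phiC _ _ q axy; lia.
  by rewrite !mulgA (raag_gen_commute axy).
exists (fun g q => (word_act a (repr g) (q, 0%R)).2) => [g h q|v q].
  rewrite (aP (repr (g * h)) (repr g ++ repr h)); last first.
    by apply/pres_classP; rewrite pres_classM !repr_classK.
  by rewrite word_act_cat aE aE /= repr_classK add0r addrC.
rewrite (aP _ [:: (v, true)]); last exact: repr_class.
by rewrite /= add0r.
Qed.
End RaagCocycle.

(** * Free-by-free Artin groups *)

Lemma edgeless_tower1 (Gam : simple_graph) :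
  finite_graph Gam -> (forall u v : Gam, ~~ adj u v) ->
  poly_fg_free_tower (raag Gam) 1.
Proof.
move=> finG noE; apply: (@tower1_of_basis _ _ (gen (@raag_rel Gam)) finG).
  by apply: pres_ind => w; exists w; rewrite word_eval_gen.
move=> w; rewrite word_eval_gen => /pres_classP.
elim=> {w} [u|u v _ IH|u v w _ IH1 _ IH2|p q x b|p q u v [x y axy]].
- exact: pres_refl.
- exact: pres_sym.
- exact: pres_trans IH1 IH2.
- exact: pres_cancel.
- by move: (noE x y); rewrite axy.
Qed.

Section Extension.
Variables (Gam : simple_graph) (m n : nat).
Notation G := (raag Gam).
Notation vgen := (gen (@raag_rel Gam)).
Variables (iota : free_group 'I_m -> G) (rho : G -> free_group 'I_n).
Hypotheses (iotaM : {morph iota : x y / x * y}) (iota_inj : injective iota)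
  (rhoM : {morph rho : x y / x * y}) (rhoS : forall w, exists g, rho g = w)
  (kerE : forall g, rho g = 1 <-> exists w, g = iota w).

Let rho1 : rho 1 = 1. Proof. exact: morph_one. Qed.
Let rhoV : {morph rho : x / x^-1}. Proof. exact: morph_inv. Qed.
Let rho_iota w : rho (iota w) = 1. Proof. by apply/kerE; exists w. Qed.

Lemma iotaJ w g : exists w', iota w ^ g = iota w'.
Proof. by apply/kerE; rewrite /conjg !rhoM rhoV rho_iota mul1g mulVg. Qed.

Lemma section_rho : exists2 s : free_group 'I_n -> G,
  {morph s : x y / x * y} & cancel s rho.
Proof.
have /choice[li liP] (i : 'I_n) := rhoS (gen _ i).
pose s : free_group 'I_n -> G := pres_lift li.
have sM : {morph s : x y / x * y} by exact: pres_liftM.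
exists s => //; apply: (@morph_gen_eq _ _ _ (rho \o s) id) => [x y|//|i].
  by rewrite /comp sM rhoM.
by rewrite /comp /s pres_lift_gen.
Qed.

(** A vertex absent from the words chosen for the generators of N and for the lifted generators of Q
    would have exponent sum 0 on all of [G], but it has exponent sum 1 on itself. *)
Lemma extension_finite_graph : finite_graph Gam.
Proof.
have [s sM sK] := section_rho.
pose W := flatten ([seq unzip1 (repr (iota (gen _ i))) | i <- enum 'I_m] ++
                   [seq unzip1 (repr (s (gen _ i))) | i <- enum 'I_n]).
have vexp0 v g : v \notin unzip1 (repr g) -> vexp v g = 0%R.
  rewrite /vexp /exp_sum; elim: (repr g) => //= -[x b] w IH.
  rewrite inE negb_or eq_sym => /andP[/negbTE vx /IH->].
  by rewrite /letter_sum /= vx if_same.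
suff WT (v : Gam) : v \in W.
  apply: (sub_finite_set _ (finite_seq W)) => v _; exact: WT.
apply/negPn/negP => vW.
have lift0 k (h : free_group 'I_k -> G) : {morph h : x y / x * y} ->
    (forall i, vexp v (h (gen _ i)) = 0%R) -> forall w, vexp v (h w) = 0%R.
  move=> hM h0; apply: gen_ind => //.
  - by rewrite (morph_one hM) (add1 (vexpM v)).
  - by move=> x y ex ey; rewrite hM vexpM ex ey.
  - by move=> x ex; rewrite (morph_inv hM) (addV (vexpM v)) ex.
have [w wE] : exists w, (s (rho (vgen v)))^-1 * vgen v = iota w.
  by apply/kerE; rewrite rhoM rhoV sK mulVg.
have : vexp v (vgen v) = 0%R; last by rewrite vexp_gen eqxx.
rewrite -[vgen v](mulVKg (s (rho (vgen v)))) wE vexpM !lift0 // => i.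
- apply: vexp0; apply: contra vW => vi; apply/flattenP.
  exists (unzip1 (repr (iota (gen _ i)))) => //.
  by rewrite mem_cat; apply/orP; left; apply/mapP; exists i; rewrite ?mem_enum.
- apply: vexp0; apply: contra vW => vi; apply/flattenP.
  exists (unzip1 (repr (s (gen _ i)))) => //.
  by rewrite mem_cat; apply/orP; right; apply/mapP; exists i; rewrite ?mem_enum.
Qed.

Lemma kernel_heisenberg (alpha beta : G -> int) :
  additive_on_group alpha -> additive_on_group beta ->
  exists gamma : G -> int, forall x y, rho x = 1 -> rho y = 1 ->
    gamma (x * y) = (gamma x + gamma y + alpha x * beta y)%R.
Proof.
move=> aM bM.
have aiM : additive_on_group (alpha \o iota) by move=> x y; rewrite /= iotaM aM.
have biM : additive_on_group (beta \o iota) by move=> x y; rewrite /= iotaM bM.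
have [gam gamM] := free_heisenberg_lift aiM biM.
(* Preimages under [iota] are chosen on the kernel; elsewhere 1 is a default. *)
have /choice[j jP] (g : G) : exists w, rho g = 1 -> g = iota w.
  have [/kerE[w ->]|ne] := pselect (rho g = 1); first by exists w.
  by exists 1.
exists (gam \o j) => x y x1 y1 /=.
have -> : j (x * y) = j x * j y.
  by apply: iota_inj; rewrite iotaM -!jP // rhoM x1 y1 mulg1.
by rewrite gamM /= -!jP.
Qed.

Lemma kernel_commute_det (alpha beta : G -> int) x y :
  additive_on_group alpha -> additive_on_group beta ->
  rho x = 1 -> rho y = 1 -> commute x y ->
  (alpha x * beta y = alpha y * beta x)%R.
Proof.
move=> aM bM x1 y1 cxy; have [gamma gM] := kernel_heisenberg aM bM.
by have := gM _ _ y1 x1; rewrite -cxy gM //; lia.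
Qed.

(** Homomorphisms that vanish on N factor through the free quotient, where the determinant identity
    holds. *)
Lemma quotient_commute_det (alpha beta : G -> int) x y :
  additive_on_group alpha -> additive_on_group beta ->
  (forall w, alpha (iota w) = 0%R) -> (forall w, beta (iota w) = 0%R) ->
  commute x y -> (alpha x * beta y = alpha y * beta x)%R.
Proof.
move=> aM bM a0 b0 cxy; have [s sM sK] := section_rho.
have descend (f : G -> int) : additive_on_group f ->
    (forall w, f (iota w) = 0%R) -> forall g, f g = f (s (rho g)).
  move=> fM f0 g; have [w wE] : exists w, (s (rho g))^-1 * g = iota w.
    by apply/kerE; rewrite rhoM rhoV sK mulVg.
  by rewrite -{1}[g](mulVKg (s (rho g))) fM wE f0 addr0.
rewrite (descend _ aM a0 x) (descend _ aM a0 y).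
rewrite (descend _ bM b0 x) (descend _ bM b0 y).
apply: (@free_commute_det _ (alpha \o s) (beta \o s)).
- by move=> u v; rewrite /= sM aM.
- by move=> u v; rewrite /= sM bM.
- by rewrite /commute -!rhoM cxy.
Qed.

(** For adjacent vertices, the determinant of their two exponent sums at the pair [a], [b] is 1. *)
Lemma kernel_independent a b :
  rho (vgen a) = 1 -> rho (vgen b) = 1 -> ~~ adj a b.
Proof.
move=> a1 b1; apply/negP => ab.
have := kernel_commute_det (vexpM a) (vexpM b) a1 b1 (raag_gen_commute ab).
rewrite !vexp_gen !eqxx eq_sym; case: eqP => // ba.
by rewrite -ba adj_irrefl in ab.
Qed.

Lemma sum_of_cosets_gen (K : G -> Prop) (f : G -> G -> int) sigma :
  (forall g h q, f (g * h) q = (f g (h * q)%g + f h q)%R) ->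
  additive_on_group sigma ->
  (forall v, sum_of_cosets K f sigma (vgen v)) ->
  forall g, sum_of_cosets K f sigma g.
Proof.
move=> fM sM gen_s; apply: gen_ind => //.
- exact: sum_of_cosets1.
- by move=> g h; apply: sum_of_cosetsM.
- by move=> g; apply: sum_of_cosetsV.
Qed.

(* Applied to the Fox derivative with respect to [a], with coefficients in the
   permutation module of the left cosets of [K]. It is well defined because
   the neighbours of [a] fix the coset [K], and its augmentation is [vexp a]. *)
Lemma kernel_exponent_finite_index (a : Gam) (K : G -> Prop) :
  K 1 -> (forall x y, K x -> K y -> K (x * y)) -> (forall x, K x -> K x^-1) ->
  (forall w, K (iota w)) -> (forall b, adj a b -> K (vgen b)) ->
  (exists w, vexp a (iota w) != 0%R) ->
  forall g, exists2 i, 0 < i & K (g ^+ i).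
Proof.
move=> K1 KM KV iotaK lkK [w aw].
pose phi (u : Gam) (q : G) : int := if u == a then Posz `[< K q >] else 0%R.
have KlkE b q : adj a b -> `[< K (vgen b * q) >] = `[< K q >].
  move=> /lkK Kb; apply/asboolP/asboolP => [Kq|]; last exact: KM.
  by have := KM _ _ (KV _ Kb) Kq; rewrite mulKg.
have [|f fM fgen] := @raag_cocycle _ phi.
  move=> u v q uv; rewrite /phi; have [ua|] := eqVneq u a; have [va|] := eqVneq v a.
  - by move: uv; rewrite ua va adj_irrefl.
  - by rewrite KlkE -?ua // addr0 add0r.
  - by rewrite KlkE -?va 1?adj_sym // addr0 add0r.
  - by [].
have fK : forall g, sum_of_cosets K f (vexp a) g.
  apply: sum_of_cosets_gen => //; first exact: vexpM.
  move=> v; exists (if v == a then [:: (1, 1%R)] else [::]).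
  split=> [q|]; rewrite ?fgen ?vexp_gen /phi /coset_sum; case: eqP => _.
  - by rewrite big_mkcond big_seq1 /= invg1 mul1g; case: asboolP.
  - by rewrite big_nil.
  - by rewrite big_seq1.
  - by rewrite big_nil.
apply: (@cocycle_finite_index _ _ KM KV f fM _ 'I_m iota) => //.
- by move=> g; exists (vexp a).
- exact: iotaJ.
(* The derivation cannot vanish on N, since its augmentation at [iota w] is the nonzero exponent sum
   of [a]. *)
apply: contrapT => f0; have [L [fL aL]] := fK (iota w).
move: aw; rewrite aL (coset_sum_eq0 K1 KM KV) ?eqxx // => q.
by rewrite -fL; apply/eqP; apply: contra_notT f0 => ne; exists w, q.
Qed.

Lemma rho_gen_trivial : (forall v, rho (vgen v) = 1) -> n = 0.
Proof.
move=> gen1.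
have r1 : forall g, rho g = 1.
  apply: gen_ind => // [x y ex ey|x ex]; first by rewrite rhoM ex ey mulg1.
  by rewrite rhoV ex invg1.
case: n rho rhoS r1 => // k r rS r1; have [g gE] := rS (gen _ ord0).
have := exp_sum_gen (R := fun _ _ => False) (h := fun _ : 'I_k.+1 => 1%R)
  (fun _ _ F => match F with end) ord0.
rewrite -gE r1 -pres_class0 exp_sum_class //.
Qed.

(** * Quotient of rank at least 2: complete bipartite graphs *)

Section HigherRank.
Hypothesis n2 : 1 < n.

(** Otherwise the preimage of the centralizer of [rho (vgen b)], which contains N and the neighbours
    of [b], has finite index. Then [rho (vgen b)] commutes with powers of two distinct free
    generators and is trivial. *)
Lemma vexp_kernel0 b : rho (vgen b) <> 1 -> forall w, vexp b (iota w) = 0%R.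
Proof.
move=> b1 w; apply/eqP; apply: contra_notT b1 => bw.
pose K g := commute (rho (vgen b)) (rho g).
have Kpow : forall g, exists2 i, 0 < i & K (g ^+ i).
  apply: (@kernel_exponent_finite_index b); rewrite /K.
  - by rewrite rho1; apply: commute1.
  - by move=> x y cx cy; rewrite rhoM; apply: commuteM.
  - by move=> x cx; rewrite rhoV; apply: commuteV.
  - by move=> w'; rewrite rho_iota; apply: commute1.
  - by move=> c bc; rewrite /commute -!rhoM (raag_gen_commute bc).
  - by exists w.
pose x0 : 'I_n := Ordinal (ltnW n2); pose x1 : 'I_n := Ordinal n2.
have [g0 g0E] := rhoS (gen _ x0); have [g1 g1E] := rhoS (gen _ x1).
have [i i0 Ki] := Kpow g0; have [j j0 Kj] := Kpow g1.
apply: (@free_centralizer _ x0 x1 i j) => //.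
- by rewrite -g0E -(morph_exp rhoM).
- by rewrite -g1E -(morph_exp rhoM).
Qed.

Lemma higher_rank_bipartite :
  ~ poly_fg_free_tower G 1 -> is_complete_bipartite Gam.
Proof.
move=> not1.
(* The exponent sums of vertices outside N descend to Q, where an edge would make a determinant
   equal to 1 vanish. *)
have Bindep b c : rho (vgen b) <> 1 -> rho (vgen c) <> 1 -> ~~ adj b c.
  move=> b1 c1; apply/negP => bc.
  have := quotient_commute_det (vexpM b) (vexpM c) (vexp_kernel0 b1)
    (vexp_kernel0 c1) (raag_gen_commute bc).
  rewrite !vexp_gen !eqxx eq_sym; case: eqP => // cb.
  by rewrite -cb adj_irrefl in bc.
(* If [a] and [b] were not adjacent, the kernel of [vexp b] would contain N and all neighbours of
   [a], hence a positive power of [b]. *)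
have AB a b : rho (vgen a) = 1 -> rho (vgen b) <> 1 -> adj a b.
  move=> a1 b1; apply/negPn/negP => nab.
  have Kpow : forall g, exists2 i, 0 < i & vexp b (g ^+ i) = 0%R.
    apply: (@kernel_exponent_finite_index a (fun g => vexp b g = 0%R)).
    - exact: add1 (vexpM b).
    - by move=> x y ex ey; rewrite vexpM ex ey.
    - by move=> x ex; rewrite (addV (vexpM b)) ex.
    - exact: vexp_kernel0.
    - move=> c ac; rewrite vexp_gen; case: eqP => // cb.
      by rewrite -cb ac in nab.
    - by have [w wE] := (kerE _).1 a1; exists w; rewrite -wE vexp_gen eqxx.
  have [i i0] := Kpow (vgen b).
  by rewrite (addX (vexpM b)) vexp_gen eqxx; lia.
pose A : {pred Gam} := fun v => `[< rho (vgen v) = 1 >].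
exists A; split.
(* With no vertex in N the graph has no edges, so the group is free of finite rank. *)
- apply: contrapT => noA; apply: not1.
  apply: edgeless_tower1 => [|u v]; first exact: extension_finite_graph.
  by apply: Bindep => e; apply: noA; [exists u | exists v]; apply/asboolP.
- apply: contrapT => noB; suff n0 : n = 0 by have := n2; rewrite n0.
  apply: rho_gen_trivial => v; apply: contrapT => v1.
  by apply: noB; exists v; apply/asboolPn.
- move=> u v; rewrite !unfold_in; case: asboolP => u1; case: asboolP => v1 /=.
  + exact/negbTE/kernel_independent.
  + exact: AB.
  + by rewrite adj_sym AB.
  + exact/negbTE/Bindep.
Qed.
End HigherRank.

(** * Infinite cyclic quotient: trees *)

Section RankOne.
Hypothesis n1 : n = 1%N.

Let total : free_group 'I_n -> int := exp_sum (fun _ => 1%R).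

Let totalM : additive_on_group total. Proof. exact: exp_sumM. Qed.

(** The projection to Q, read in the integers; its kernel is N. *)
Definition height (g : G) : int := total (rho g).

Lemma heightM : additive_on_group height.
Proof. by move=> x y; rewrite /height rhoM totalM. Qed.

Lemma height_kernel g : height g = 0%R <-> rho g = 1.
Proof.
rewrite /height; split=> [|->]; last exact/add1/totalM.
pose x : 'I_n := Ordinal (eq_leq (esym n1)).
have xE (y : 'I_n) : y = x.
  apply: val_inj; apply/eqP; rewrite -leqn0 -ltnS.
  exact: leq_trans (ltn_ord y) (eq_leq n1).
have [i [j ->]] := free_rank_one (rho g) xE.
rewrite totalM (addV totalM) !(addX totalM) /total exp_sum_gen // => e.
by have -> : i = j; [lia | rewrite mulgV].
Qed.

Lemma height_one : exists t, height t = 1%R.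
Proof.
have [t tE] := rhoS (gen _ (Ordinal (eq_leq (esym n1)))).
by exists t; rewrite /height tE /total exp_sum_gen.
Qed.

Lemma not_all_powers_kernel :
  ~ forall g, exists2 i, 0 < i & rho (g ^+ i) = 1.
Proof.
have [t tE] := height_one => /(_ t)[i i0 /height_kernel].
by rewrite (addX heightM) tE; lia.
Qed.

(* [w v] is a power of [v], with exponents chosen to equalise the heights. *)
Lemma equal_heights (s : seq Gam) : (forall v, v \in s -> rho (vgen v) <> 1) ->
  exists M (w : Gam -> G),
    [/\ forall v (P : G -> Prop), P 1 -> (forall x y, P x -> P y -> P (x * y)) ->
          (forall x, P x -> P x^-1) -> P (vgen v) -> P (w v),
        (0 < M)%N, forall v, v \in s -> height (w v) = Posz M
      & forall v, v \in s -> vexp v (w v) != 0%R].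
Proof.
move=> sB; pose a v := `|height (vgen v)|%N.
have a0 v : v \in s -> 0 < a v.
  move=> /sB v1; rewrite absz_gt0; apply/eqP => h0.
  by apply: v1; apply/height_kernel.
pose M := (\prod_(v <- s) a v)%N.
have M0 : 0 < M by rewrite /M big_seq prodn_cond_gt0.
have aM v : v \in s -> a v %| M by move=> vs; rewrite /M (big_rem v) //= dvdn_mulr.
(* Inverting when the height is negative gives all vertices of [s] the same height, sign
   included. *)
pose w v := if (0 < height (vgen v))%R then vgen v ^+ (M %/ a v)
            else (vgen v ^+ (M %/ a v))^-1.
have k0 v : v \in s -> 0 < M %/ a v.
  by move=> vs; rewrite divn_gt0 ?a0 // dvdn_leq // aM.
exists M, w; split=> // [v P P1 PM PV Pv|v vs|v vs].
- have Pk k : P (vgen v ^+ k) by elim: k => // k IH; rewrite expgS; apply: PM.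
  by rewrite /w; case: ifP => _ //; apply: PV.
- have := divnK (aM v vs); rewrite /w; move: (M %/ a v) => k; rewrite /a => <-.
  by case: ifP => h0; rewrite ?(addV heightM) (addX heightM); lia.
- have := k0 v vs; rewrite /w; case: ifP => _ kp.
    by rewrite (addX (vexpM v)) vexp_gen eqxx; lia.
  by rewrite (addV (vexpM v)) (addX (vexpM v)) vexp_gen eqxx; lia.
Qed.

(** The hypothesis places [w v] in every subgroup that contains [v], here in the kernel of
    [vexp u]. *)
Lemma vexp_power0 (w : Gam -> G) u v :
  (forall v (P : G -> Prop), P 1 -> (forall x y, P x -> P y -> P (x * y)) ->
     (forall x, P x -> P x^-1) -> P (vgen v) -> P (w v)) ->
  u != v -> vexp u (w v) = 0%R.
Proof.
move=> wP uv; apply: (wP v (fun g => vexp u g = 0%R)).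
- exact: add1 (vexpM u).
- by move=> x y ex ey; rewrite vexpM ex ey.
- by move=> x ex; rewrite (addV (vexpM u)) ex.
- by rewrite vexp_gen eq_sym (negbTE uv).
Qed.

(** For distinct neighbours [b] and [c], the element [w b / w c] of N commutes with [a], and the
    determinant of [vexp a] and [vexp b] at these two elements is the nonzero number
    [vexp b (w b)]. *)
Lemma kernel_gen_leaf a b c :
  rho (vgen a) = 1 -> adj a b -> adj a c -> b = c.
Proof.
move=> a1 ab ac; apply/eqP/negPn/negP => nbc.
have nB d : adj a d -> rho (vgen d) <> 1.
  by move=> ad d1; move: (kernel_independent a1 d1); rewrite ad.
have [|M [w [wP M0 hw vw]]] := @equal_heights [:: b; c].
  by move=> v; rewrite !inE => /orP[]/eqP->; apply: nB.
have y1 : rho (w b * (w c)^-1) = 1.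
  by apply/height_kernel; rewrite heightM (addV heightM) !hw ?inE ?eqxx ?orbT //; lia.
have wC d : adj a d -> commute (vgen a) (w d).
  move=> ad; apply: (wP d (commute (vgen a))).
  - exact: commute1.
  - by move=> x y; apply: commuteM.
  - by move=> x; apply: commuteV.
  - exact: raag_gen_commute.
have := kernel_commute_det (vexpM a) (vexpM b) a1 y1
  (commuteM (wC b ab) (commuteV (wC c ac))).
rewrite !vexp_gen eqxx !vexpM !(addV (vexpM _)).
rewrite (vexp_power0 wP nbc) => e.
have nab : (a == b) = false by apply/eqP => e'; rewrite e' adj_irrefl in ab.
by move: (vw b); rewrite inE eqxx => /(_ isT); move: e; rewrite nab; lia.
Qed.

(** For an isolated vertex in N the finite index criterion applies to N itself, but N has infinite
    index. *)
Lemma kernel_gen_neighbour a : rho (vgen a) = 1 ->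
  exists2 b, adj a b & rho (vgen b) <> 1.
Proof.
move=> a1; have [[b ab]|noN] := pselect (exists b, adj a b).
  by exists b => // b1; move: (kernel_independent a1 b1); rewrite ab.
exfalso; apply: not_all_powers_kernel.
apply: (@kernel_exponent_finite_index a (fun g => rho g = 1)) => //.
- by move=> x y ex ey; rewrite rhoM ex ey mulg1.
- by move=> x ex; rewrite rhoV ex invg1.
- by move=> b ab; case: noN; exists b.
- by have [w wE] := (kerE _).1 a1; exists w; rewrite -wE vexp_gen eqxx.
Qed.

(* If [U] is a union of connected components, the derivation that is principal
   on [U] and zero on its complement vanishes on the kernel of [rho]. *)
Lemma rank_one_connected (U : {pred Gam}) :
  (forall x y, adj x y -> (x \in U) = (y \in U)) ->
  forall u v, u \in U -> v \in U.
Proof.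
move=> Uadj u v uU; apply/negPn/negP => vU.
have Bmem x : exists2 b, rho (vgen b) <> 1 & (b \in U) = (x \in U).
  have [/kernel_gen_neighbour[b xb b1]|x1] := pselect (rho (vgen x) = 1).
    by exists b => //; rewrite (Uadj _ _ xb).
  by exists x.
have [b b1 bU] := Bmem u; rewrite uU in bU.
have [c c1 cU] := Bmem v; rewrite (negbTE vU) in cU.
pose N g := rho g = 1.
have NM x y : N x -> N y -> N (x * y) by rewrite /N rhoM => -> ->; rewrite mulg1.
have NV x : N x -> N x^-1 by rewrite /N rhoV => ->; rewrite invg1.
(* The principal derivation given by the trivial coset: [d x] is the coset of the inverse of [x]
   minus the trivial coset, of augmentation 0. *)
pose d (x : G) (q : G) : int := (Posz `[< N (x * q)%g >] - Posz `[< N q >])%R.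
pose phi (x : Gam) (q : G) : int := if x \in U then d (vgen x) q else 0%R.
have [|f fM fgen] := @raag_cocycle _ phi.
  move=> x y q xy; rewrite /phi (Uadj _ _ xy); case: ifP => // _; rewrite /d.
  by rewrite !mulgA (raag_gen_commute xy); ring.
have fN : forall g, sum_of_cosets N f (fun _ => 0%R) g.
  apply: sum_of_cosets_gen => // x; exists
    (if x \in U then [:: ((vgen x)^-1, 1%R); (1, (-1)%R)] else [::]).
  split=> [q|]; rewrite ?fgen /phi; case: ifP => _; rewrite ?big_nil //.
  - rewrite /d /coset_sum big_mkcond !big_cons big_nil /= invgK invg1 mul1g.
    by do 2!case: asboolP => _.
  - by rewrite /coset_sum big_nil.
  - by rewrite !big_cons big_nil.
have fker w q : f (iota w) q = 0%R.
  apply/eqP/negPn/negP => ne; apply: not_all_powers_kernel.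
  apply: (@cocycle_finite_index _ N NM NV f fM _ 'I_m iota) => //.
  - by move=> g; exists (fun _ => 0%R).
  - exact: iotaJ.
  - by exists w, q.
have [|M [w [wP M0 hw vw]]] := @equal_heights [:: b; c].
  by move=> x; rewrite !inE => /orP[]/eqP->.
have y1 : rho (w b * (w c)^-1) = 1.
  by apply/height_kernel; rewrite heightM (addV heightM) !hw ?inE ?eqxx ?orbT //; lia.
have fb q : f (w b) q = d (w b) q.
  move: q; apply: (wP b (fun g => forall q, f g q = d g q)).
  - by move=> q; rewrite (cocycle1 fM) /d mul1g subrr.
  - by move=> x y fx fy q; rewrite fM fx fy /d mulgA; ring.
  - by move=> x fx q; rewrite (cocycleV fM) fx /d mulVKg; ring.
  - by move=> q; rewrite fgen /phi bU.
have fc q : f (w c) q = 0%R.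
  move: q; apply: (wP c (fun g => forall q, f g q = 0%R)).
  - by move=> q; rewrite (cocycle1 fM).
  - by move=> x y fx fy q; rewrite fM fx fy.
  - by move=> x fx q; rewrite (cocycleV fM) fx.
  - by move=> q; rewrite fgen /phi cU.
(* On [w b / w c] the derivation has value 1 at the identity: this element lies in N, and the
   inverse of [w c], of nonzero height, does not. *)
have [w0 w0E] := (kerE _).1 y1.
have := fker w0 1; rewrite -w0E fM (cocycleV fM) fc fb /d mulg1 (asboolT y1).
rewrite asboolF; first by [].
move=> /height_kernel; rewrite (addV heightM) hw ?inE ?eqxx ?orbT //; lia.
Qed.

(* With heights equalised, consecutive vertices of a cycle [v1, v2, ..., vr]
   give elements [w vi / w v(i+1)] of the kernel, and the products of their
   k-th powers along the cycle telescope to 1 for every k. The second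
   difference [D] of the Heisenberg function of (vexp v1, vexp v2) along these
   products jumps only at [v1] and [v2], and the jumps do not add up to 0. *)
Lemma rank_one_acyclic : acyclic_graph Gam.
Proof.
move=> c csize /andP[cadj cuniq].
(* A vertex in N has at most one neighbour, whereas a vertex of the cycle has two. *)
have cB v : v \in c -> rho (vgen v) <> 1.
  move=> vc v1; have [i s rs] := rot_to vc.
  move: csize cuniq cadj; rewrite -(size_rot i) -(rot_uniq i) -(rot_cycle i) rs.
  case: s {rs} => [//|y s]; case/lastP: s => [//|s z] _.
  rewrite /= rcons_path last_rcons => /and3P[_ yz _] /and3P[vy _ zv].
  rewrite adj_sym in zv; move: yz.
  by rewrite (kernel_gen_leaf v1 vy zv) mem_rcons inE eqxx.
have [M [w [wP M0 hw vw]]] := equal_heights cB.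
case: c csize cadj cuniq cB hw vw => [//|v1 [//|v2 [//|v3 s]]] _ cadj cuniq cB hw vw.
set c := [:: v1, v2, v3 & s] in cB hw vw.
pose al := vexp v1; pose be := vexp v2.
have [gam gamM] := kernel_heisenberg (vexpM v1) (vexpM v2).
have alM : additive_on_group al := vexpM v1.
have beM : additive_on_group be := vexpM v2.
have gam1 : gam 1 = 0%R.
  by have := gamM 1 1 rho1 rho1; rewrite mulg1 (add1 (vexpM v1)); lia.
pose D v := (gam (w v1 ^+ 2 / w v ^+ 2)%g - gam (w v1 / w v)%g *+ 2)%R.
have v1c : v1 \in c by rewrite inE eqxx.
(* As [w u] and [w v] commute, the square of [w u / w v] is the quotient of their squares. In the
   second difference [gam (w u / w v)] cancels, and only values of [al] and [be] remain. *)
have step u v : u \in c -> v \in c -> adj u v ->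
    D v = (D u + (al (w v1) *+ 2 - al (w u) - al (w v)) * (be (w u) - be (w v)))%R.
  move=> uc vc uv.
  have kerw x y : x \in c -> y \in c -> rho (w x / w y) = 1.
    by move=> xc yc; apply/height_kernel; rewrite heightM (addV heightM) !hw //; lia.
  have kerw2 x y : x \in c -> y \in c -> rho (w x ^+ 2 / w y ^+ 2) = 1.
    move=> xc yc; apply/height_kernel.
    by rewrite heightM (addV heightM) !(addX heightM) !hw //; lia.
  have cwuv : commute (w u) (w v).
    apply: (wP v (commute (w u))); [exact: commute1| | |].
    - by move=> x y; apply: commuteM.
    - by move=> x; apply: commuteV.
    apply/commute_sym/(wP u (commute (vgen v))); [exact: commute1| | |].
    - by move=> x y; apply: commuteM.
    - by move=> x; apply: commuteV.
    - by apply: raag_gen_commute; rewrite adj_sym.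
  have e1 : w v1 / w v = (w v1 / w u) * (w u / w v) by rewrite mulgA mulgVK.
  have e2 : w v1 ^+ 2 / w v ^+ 2 =
      (w v1 ^+ 2 / w u ^+ 2) * ((w u / w v) * (w u / w v)).
    by rewrite -expg2 expgnFl // mulgA mulgVK.
  have ker2 : rho ((w u / w v) * (w u / w v)) = 1 by rewrite rhoM kerw // mulg1.
  rewrite /D e1 e2 (gamM _ _ (kerw2 _ _ v1c uc) ker2).
  rewrite !(gamM _ _ (kerw _ _ _ _) (kerw _ _ _ _)) // -/al -/be.
  rewrite !(alM, beM, addV alM, addV beM, addX alM, addX beM).
  ring.
have w0 : forall x y, x != y -> vexp x (w y) = 0%R.
  by move=> x y; apply: vexp_power0.
have D1 : D v1 = 0%R by rewrite /D !mulgV gam1 mul0rn subr0.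
move: cuniq cadj; rewrite /= !inE !negb_or.
move=> /and4P[/and3P[n12 n13 v1s] /andP[n23 v2s] v3s _] /and3P[a12 a23 path3].
have al2 : al (w v2) = 0%R by exact: w0.
have be1 : be (w v1) = 0%R by apply: w0; rewrite eq_sym.
have al3 : al (w v3) = 0%R by exact: w0.
have be3 : be (w v3) = 0%R by exact: w0.
have D2 := step v1 v2 v1c _ a12; have D3 := step v2 v3 _ _ a23.
have sc x : x \in v3 :: s -> x \in c by move=> xs; rewrite /c 2!inE xs !orbT.
(* Beyond [v2] all values of [be] vanish, so [D] stays constant. *)
have tail : forall p x, x \in v3 :: s -> {subset p <= s} -> path adj x p ->
    D (last x p) = D x /\ last x p \in v3 :: s.
  elim=> [|y p IH] x xs ps //= /andP[xy yp].
  have ys : y \in v3 :: s by rewrite inE ps ?orbT ?mem_head.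
  have [|-> ->] := IH y ys _ yp; first by move=> z zp; apply: ps; rewrite inE zp orbT.
  split=> //; rewrite (step x y) ?sc //.
  have be0 z : z \in v3 :: s -> be (w z) = 0%R.
    rewrite inE => zs; apply: w0; apply: contraTneq zs => <-.
    by rewrite negb_or n23.
  by rewrite !be0 // subrr mulr0 addr0.
move: path3; rewrite rcons_path => /andP[p3 lastv1].
have [DL Ls] := tail s v3 (mem_head _ _) (fun _ H => H) p3.
have beL : be (w (last v3 s)) = 0%R.
  move: Ls; rewrite inE => zs; apply: w0; apply: contraTneq zs => <-.
  by rewrite negb_or n23.
have DC := step _ v1 (sc _ Ls) v1c lastv1.
have m2 : v2 \in c by rewrite !inE eqxx orbT.
have m3 : v3 \in c by rewrite !inE eqxx !orbT.
have := vw v1 v1c; have := vw v2 m2; rewrite -/al -/be => b2 a1.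
have : (al (w v1) * be (w v2) == 0)%R; last by rewrite mulf_eq0 (negbTE b2) (negbTE a1).
(* Write A for [al (w v1)] and B for [be (w v2)]. From 0 at [v1], [D] falls by AB on the first edge,
   rises by 2AB on the second and then stays constant; back at [v1] this gives AB = 0. *)
move: DC; rewrite DL (D3 m2 m3) (D2 m2) D1 beL be1 al2 be3 al3 => /eqP.
rewrite subrr mulr0 addr0 eq_sym; apply: etrans; congr (_ == _); ring.
Qed.

Lemma rank_one_tree : ~ poly_fg_free_tower G 1 ->
  is_tree Gam /\ exists u v : Gam, u != v.
Proof.
move=> not1; have [[u [v uv]]|noE] := pselect (exists u v : Gam, adj u v); last first.
  case: not1; apply: edgeless_tower1 => [|u v]; first exact: extension_finite_graph.
  by apply/negP => uv; apply: noE; exists u, v.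
split; last by exists u, v; apply: contraTneq uv => ->; rewrite adj_irrefl.
split; last exact: rank_one_acyclic.
split; first exact: inhabits u.
move=> x y.
pose U : {pred Gam} := fun z => `[< exists2 p, path adj x p & last x p = z >].
have Uext z z' : adj z z' -> z \in U -> z' \in U.
  move=> zz' /asboolP[p xp pz]; apply/asboolP; exists (rcons p z').
    by rewrite rcons_path xp pz.
  by rewrite last_rcons.
suff : y \in U by move/asboolP.
apply: (@rank_one_connected U) (x) _ _.
  by move=> z z' zz'; apply/idP/idP; apply: Uext; rewrite // adj_sym.
by apply/asboolP; exists [::].
Qed.
End RankOne.
End Extension.

(** * Towers for bipartite graphs and trees *)

(** A tower of length 1 is read as an extension with trivial kernel, free on ['I_0]. The determinant
    identity then applies to the two ends of the edge. *)
Lemma edge_no_short_tower (Gam : simple_graph) (u v : Gam) M :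
  adj u v -> poly_fg_free_tower (raag Gam) M -> 2 <= M.
Proof.
move=> uv; case: M => [|[|//]] =>
  [[T [T0 T1 _]]|/tower1_free[n [rho [rhoM rhoS rho1]]]].
  have /eqP e : gen (@raag_rel Gam) u == 1 by rewrite -T0 T1.
  by have := vexp_gen u u; rewrite e (add1 (vexpM u)) eqxx.
have kerE g : rho g = 1 <-> exists w : free_group 'I_0, g = (fun=> 1) w.
  by split=> [/rho1->|[_ ->]]; [exists 1 | exact: morph_one].
have := quotient_commute_det rhoM rhoS kerE (vexpM u) (vexpM v)
  (fun=> add1 (vexpM u)) (fun=> add1 (vexpM v)) (raag_gen_commute uv).
rewrite !vexp_gen !eqxx eq_sym; case: eqP => // vu.
by rewrite vu adj_irrefl in uv.
Qed.

Lemma finite_subgraph (Gam : simple_graph) (P : pred Gam) :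
  finite_graph Gam -> finite_set [set: {v : Gam | P v}].
Proof.
move=> /finite_seqP[s sE]; pose t : seq {v : Gam | P v} := pmap insub s.
apply: (sub_finite_set _ (finite_seq t)) => y _ /=; rewrite mem_pmap_sub.
by have : [set: Gam]%classic (val y) by []; rewrite sE.
Qed.

(** * Retractions onto independent sets of vertices *)

Section Retraction.
Variables (Gam : simple_graph) (P : pred Gam).
Hypothesis indepP : forall u v : Gam, P u -> P v -> ~~ adj u v.
Notation vgen := (gen (@raag_rel Gam)).

Definition retract_gen (v : Gam) : free_group {v : Gam | P v} :=
  if insub v is Some y then gen _ y else 1.

Definition retract : raag Gam -> free_group {v : Gam | P v} := pres_lift retract_gen.

Lemma retract_gen_commute u v : adj u v -> commute (retract_gen u) (retract_gen v).
Proof.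
rewrite /retract_gen; case: insubP => [x Pu _|_ _]; last exact/commute_sym/commute1.
case: insubP => [y Pv _|_ _]; last exact: commute1.
by rewrite (negbTE (indepP Pu Pv)).
Qed.

Lemma retractM : {morph retract : x y / x * y}.
Proof. exact/pres_liftM/raag_rel_word_eval/retract_gen_commute. Qed.

Lemma retract_vgen v : retract (vgen v) = retract_gen v.
Proof. exact/pres_lift_gen/raag_rel_word_eval/retract_gen_commute. Qed.

Lemma retract_in (y : {v : Gam | P v}) : retract (vgen (val y)) = gen _ y.
Proof. by rewrite retract_vgen /retract_gen valK. Qed.

Lemma retract_out v : ~~ P v -> retract (vgen v) = 1.
Proof. by move=> nPv; rewrite retract_vgen /retract_gen insubN. Qed.

Definition inclusion : free_group {v : Gam | P v} -> raag Gam :=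
  pres_lift (fun y => vgen (val y)).

Lemma inclusionM : {morph inclusion : x y / x * y}.
Proof. exact: pres_liftM. Qed.

Lemma inclusion_gen y : inclusion (gen _ y) = vgen (val y).
Proof. exact: pres_lift_gen. Qed.
End Retraction.

(** The group is the direct product of the free groups on the two sides, so the retraction onto one
    side has the other as kernel. The map [dec] is this decomposition. *)
Lemma bipartite_tower2 (Gam : simple_graph) :
  finite_graph Gam -> is_complete_bipartite Gam -> poly_fg_free_tower (raag Gam) 2.
Proof.
move=> finG [A [_ _ adjE]].
pose PA : pred Gam := fun v => v \in A; pose PB : pred Gam := fun v => v \notin A.
have indA u v : PA u -> PA v -> ~~ adj u v by rewrite /PA adjE => -> ->.
have indB u v : PB u -> PB v -> ~~ adj u v.
  by rewrite /PB adjE => /negbTE-> /negbTE->.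
pose vgen := gen (@raag_rel Gam).
have rAM := retractM indA; have rBM := retractM indB.
have iAM := @inclusionM Gam PA; have iBM := @inclusionM Gam PB.
have iAB x y : commute (inclusion (P := PA) x) (inclusion (P := PB) y).
  move: x; apply: gen_ind => [|a|g h cg ch|g cg].
  - by rewrite (morph_one iAM); apply/commute_sym/commute1.
  - move: y; apply: gen_ind => [|b|g h cg ch|g cg].
    + by rewrite (morph_one iBM); apply: commute1.
    + rewrite !inclusion_gen; apply: raag_gen_commute.
      have aA : val a \in A := valP a; have bA : val b \notin A := valP b.
      by rewrite adjE aA (negbTE bA).
    + by rewrite iBM; apply: commuteM.
    + by rewrite (morph_inv iBM); apply: commuteV.
  - by rewrite iAM; apply/commute_sym/commuteM; apply: commute_sym.
  - by rewrite (morph_inv iAM); apply/commute_sym/commuteV/commute_sym.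
pose dec g := inclusion (retract PA g) * inclusion (retract PB g).
have decM : {morph dec : x y / x * y}.
  move=> x y; rewrite /dec rAM rBM iAM iBM -!mulgA; congr (_ * _).
  by rewrite !mulgA; congr (_ * _); apply: iAB.
have decE : dec =1 id.
  apply: morph_gen_eq => // v; rewrite /dec.
  have [vA|vA] := boolP (v \in A).
    have -> : v = val (exist PA v vA) by [].
    rewrite (retract_in indA) inclusion_gen (retract_out indB) ?(morph_one iBM).
      by rewrite mulg1.
    by rewrite /PB vA.
  have -> : v = val (exist PB v vA) by [].
  rewrite (retract_in indB) inclusion_gen (retract_out indA) ?(morph_one iAM) //.
  by rewrite mul1g.
apply: (@tower2_of_retraction _ _ _ (retract PB) (fun y => vgen (val y))
  (fun z : {v | PA v} => vgen (val z))) => //.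
- exact: finite_subgraph.
- exact: finite_subgraph.
- exact: retract_in.
- by move=> z; apply: (retract_out indB); rewrite /PB negbK; apply: valP.
- move=> g g1; exists (repr (retract PA g)); rewrite -[LHS]decE /dec g1.
  by rewrite (morph_one iBM) mulg1.
- move=> w /(congr1 (retract PA)); rewrite (morph_one rAM) (morph_word_eval rAM).
  rewrite (@eq_word_eval _ _ _ (gen (fun _ _ => False))) => [|z]; last first.
    exact: retract_in.
  by rewrite word_eval_gen => /pres_classP.
Qed.

(** * Rooted trees and their Artin groups *)

(** The parent is the previous vertex on a shortest path from the root. An edge that joins no vertex
    to its parent would close a cycle with the parent edges. *)
Lemma tree_parent (Gam : simple_graph) (r : Gam) : is_tree Gam ->
  exists (par : Gam -> Gam) (d : Gam -> nat),
    [/\ d r = 0, forall v, v != r -> adj v (par v) /\ d v = (d (par v)).+1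
      & forall u v, adj u v -> (u != r /\ par u = v) \/ (v != r /\ par v = u)].
Proof.
case=> -[_ conn] acyc.
pose D v k := exists p : seq Gam, [/\ path adj r p, last r p = v & size p = k].
have /choice[d dP] : forall v, exists k, D v k /\ forall l, D v l -> k <= l.
  move=> v.
  have [p rp pv] := conn r v.
  have exD : exists k, `[< D v k >] by exists (size p); apply/asboolP; exists p.
  exists (ex_minn exD); case: ex_minnP => k /asboolP Dk kmin; split=> // l Dl.
  by apply: kmin; apply/asboolP.
have dr : d r = 0.
  by apply/eqP; rewrite -leqn0; apply: (dP r).2; exists [::].
have /choice[par parP] : forall v, exists w, v != r -> adj v w /\ d v = (d w).+1.
  move=> v; have [->|vr] := eqVneq v r; first by exists r.
  have [[p [rp pv sp]] dmin] := dP v.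
  case/lastP: p rp pv sp => [_ /= rv|p x]; first by rewrite rv eqxx in vr.
  rewrite rcons_path last_rcons size_rcons => /andP[rp px] xv sp.
  exists (last r p) => _; rewrite adj_sym -xv; split=> //; apply/eqP.
  rewrite xv eqn_leq; apply/andP; split.
    have [[q [rq qv <-]] _] := dP (last r p); apply: dmin.
    exists (rcons q v); rewrite rcons_path last_rcons size_rcons rq qv -xv.
    by rewrite px.
  by rewrite -sp ltnS; apply: (dP _).2; exists p.
exists par, d; split=> // u v uv.
pose te : rel Gam := fun x y => (x != r) && (par x == y) || (y != r) && (par y == x).
have te_adj : subrel te adj.
  by move=> x y /orP[|] /andP[/parP[axy _] /eqP<-] //; rewrite adj_sym.
suff: te u v by case/orP=> /andP[? /eqP ?]; [left | right].
apply/negPn/negP => nte.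
have up : forall k x, d x = k -> exists2 p, path te x p & last x p = r.
  elim=> [|k IH] x dx; have [->|xr] := eqVneq x r; try by exists [::].
    by have [_] := parP x xr; rewrite dx.
  have [_ dpx] := parP x xr; have [|p pp pr] := IH (par x); first by lia.
  by exists (par x :: p); rewrite //= pp /te xr eqxx.
have down : forall k x, d x = k -> exists2 p, path te r p & last r p = x.
  elim=> [|k IH] x dx; have [->|xr] := eqVneq x r; try by exists [::].
    by have [_] := parP x xr; rewrite dx.
  have [_ dpx] := parP x xr; have [|p pp pr] := IH (par x); first by lia.
  exists (rcons p x); last by rewrite last_rcons.
  by rewrite rcons_path pp pr /te xr eqxx orbT.
have [p up_p up_r] := up _ u erefl; have [q down_q down_v] := down _ v erefl.
have : path te u (p ++ q) by rewrite cat_path up_p up_r.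
have : last u (p ++ q) = v by rewrite last_cat up_r.
(* The walk through the root is shortened to a path without repetition. It has at least three
   vertices because [u] and [v] are not joined by a parent edge. *)
move: (p ++ q) => l lv ul; case/shortenP: ul lv => l' ul' uniq_l' _ lv.
apply: (acyc (u :: l')); last first.
  by rewrite /ucycle uniq_l' /= rcons_path (sub_path te_adj ul') lv adj_sym uv.
case: l' lv ul' {uniq_l'} => [/= e|x [/= e|//]].
  by rewrite e adj_irrefl in uv.
by rewrite e (negbTE nte).
Qed.

(* Conjugation by the root [r] acts on the kernel of the height function, which
   is free on the elements [e_v = v / par v], by the automorphism [tau]. In it
   [v] equals [E_v * r], where [E_v] is the product of the [e_x] along the path
   from [v] up to the root. [E'_v] is the same product in the reverse order. *)
Lemma tree_tower2 (Gam : simple_graph) :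
  finite_graph Gam -> is_tree Gam -> poly_fg_free_tower (raag Gam) 2.
Proof.
move=> finG treeG; have [[[r] _] _] := treeG.
have [par [d [dr parP edgeP]]] := tree_parent r treeG.
pose PZ : pred Gam := fun v => v != r; pose Z := {v : Gam | PZ v}.
pose F := free_group Z; pose vgen := gen (@raag_rel Gam).
pose e (v : Gam) : F := if insub v is Some z then gen _ z else 1.
have eZ (z : Z) : e (val z) = gen _ z by rewrite /e valK.
(* The depth of the vertex serves as fuel for the recursion up to the root. *)
pose Ek := fix E k v : F := if k is k'.+1 then e v * E k' (par v) else 1.
pose Ek' := fix E k v : F := if k is k'.+1 then E k' (par v) * e v else 1.
pose E v := Ek (d v) v; pose E' v := Ek' (d v) v.
have ES v : v != r -> E v = e v * E (par v) by move=> /parP[_ dv]; rewrite /E dv.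
have ES' v : v != r -> E' v = E' (par v) * e v by move=> /parP[_ dv]; rewrite /E' dv.
have Er : E r = 1 by rewrite /E dr.
have Er' : E' r = 1 by rewrite /E' dr.
have parind (P : Gam -> Prop) :
    P r -> (forall v, v != r -> P (par v) -> P v) -> forall v, P v.
  move=> Pr PS v; have [k] := ubnP (d v); elim: k v => // k IH v ltk.
  have [->//|vr] := eqVneq v r; apply: PS => //; apply: IH.
  by have [_ dv] := parP v vr; rewrite dv in ltk.
(* The formula is forced: [par v] commutes with [v], hence with [e v], and it equals [E (par v)]
   times the root. *)
pose tau : F -> F := pres_lift
  (fun z : Z => (E (par (val z)))^-1 * (e (val z) * E (par (val z)))).
pose tau' : F -> F := pres_lift
  (fun z : Z => E' (par (val z)) * (e (val z) * (E' (par (val z)))^-1)).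
have tauM : {morph tau : x y / x * y} by exact: pres_liftM.
have tauM' : {morph tau' : x y / x * y} by exact: pres_liftM.
have tau_e v : v != r -> tau (e v) = (E (par v))^-1 * (e v * E (par v)).
  move=> vr; have -> : v = val (exist PZ v vr : Z) by [].
  by rewrite {1}eZ /tau pres_lift_gen.
have tau_e' v : v != r -> tau' (e v) = E' (par v) * (e v * (E' (par v))^-1).
  move=> vr; have -> : v = val (exist PZ v vr : Z) by [].
  by rewrite {1}eZ /tau' pres_lift_gen.
(* Because [tau] carries [E'] to [E], its inverse [tau'] is obtained by conjugating with [E']. *)
have tauE' : forall v, tau (E' v) = E v.
  apply: parind => [|v vr IH]; first by rewrite Er' Er (morph_one tauM).
  by rewrite ES' // tauM IH tau_e // mulVKg -ES.
have tau'E : forall v, tau' (E v) = E' v.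
  apply: parind => [|v vr IH]; first by rewrite Er' Er (morph_one tauM').
  by rewrite ES // tauM' IH tau_e' // -!mulgA mulVg mulg1 -ES'.
have tauK' : cancel tau' tau.
  apply: (@morph_gen_eq _ _ _ (tau \o tau') id) => [x y|//|z].
    by rewrite /comp tauM' tauM.
  have zr : val z != r := valP z.
  rewrite /comp -eZ tau_e' // !tauM (morph_inv tauM) !tauE' tau_e //.
  by rewrite -!mulgA mulVKg mulgV mulg1.
have tauK : cancel tau tau'.
  apply: (@morph_gen_eq _ _ _ (tau' \o tau) id) => [x y|//|z].
    by rewrite /comp tauM tauM'.
  have zr : val z != r := valP z.
  rewrite /comp -eZ tau_e // !tauM' (morph_inv tauM') !tau'E tau_e' //.
  by rewrite -!mulgA mulVg mulg1 mulKg.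
(* The vertex [v] acts as [E v] times the root: first [tau], then left multiplication by [E v]. *)
pose a (l : Gam * bool) (f : F) :=
  if l.2 then E l.1 * tau f else tau' ((E l.1)^-1 * f).
have aP u v : pres_eq (@raag_rel Gam) u v -> word_act a u =1 word_act a v.
  apply: word_act_pres => [x b f|_ _ f [x y axy]].
    by case: b; rewrite /a /= ?tauK' ?mulVKg // mulKg tauK.
  rewrite /a /= !tauM !mulgA; congr (_ * _).
  have comm v' : v' != r -> E v' * tau (E (par v')) = E (par v') * tau (E v').
    by move=> vr; rewrite !(ES v') // tauM tau_e // !mulgA mulgV mul1g.
  by case: (edgeP _ _ axy) => -[nr <-]; rewrite comm.
pose act (g : raag Gam) (f : F) := word_act a (repr g) f.
have act_class w f : act (pres_class _ w) f = word_act a w f.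
  exact/aP/repr_class.
have actM g h f : act (g * h) f = act g (act h f).
  rewrite -(repr_classK g) -(repr_classK h) -pres_classM !act_class.
  exact: word_act_cat.
have act1 f : act 1 f = f by rewrite -pres_class0 act_class.
pose psi (z : Z) : raag Gam := vgen (val z) / vgen (par (val z)).
pose iota : F -> raag Gam := pres_lift psi.
have iotaM : {morph iota : x y / x * y} by exact: pres_liftM.
have iota_gen z : iota (gen _ z) = psi z by exact: pres_lift_gen.
have iota_e v : v != r -> iota (e v) = vgen v / vgen (par v).
  move=> vr; have -> : v = val (exist PZ v vr : Z) by [].
  by rewrite {1}eZ iota_gen.
have iotaE : forall v, iota (E v) = vgen v / vgen r.
  apply: parind => [|v vr IH]; first by rewrite Er (morph_one iotaM) mulgV.
  by rewrite ES // iotaM IH iota_e // mulgA mulgVK.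
have iota_tau f : vgen r * iota f / vgen r = iota (tau f).
  apply: (@morph_gen_eq _ _ _ (fun f => vgen r * iota f / vgen r) (iota \o tau)).
  - by move=> x y; rewrite iotaM !mulgA mulgVK.
  - by move=> x y; rewrite /comp tauM iotaM.
  move=> z; have zr : val z != r := valP z.
  rewrite /comp -eZ tau_e // iotaM (morph_inv iotaM) iotaM !iotaE iota_e //.
  rewrite invgM invgK !mulgA mulgVK -!mulgA; congr (_ * _); rewrite !mulgA.
  congr (_ / _); apply/commuteV/raag_gen_commute; exact: (parP _ zr).1.
(* Elements of [F] act by left translation, which makes [iota] injective. *)
have act_iota x : forall f, act (iota x) f = x * f.
  move: x; apply: gen_ind => [f|z f|x y IHx IHy f|x IH f].
  - by rewrite (morph_one iotaM) act1 mul1g.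
  - have zr : val z != r := valP z.
    rewrite iota_gen /psi actM -pres_class_genV !act_class /= /a /= tauK'.
    by rewrite ES // eZ mulgA mulgK.
  - by rewrite iotaM actM IHy IHx mulgA.
  - rewrite (morph_inv iotaM) -{1}(mulVKg x f) -IH.
    by rewrite -actM mulVg act1.
pose zeta : raag Gam -> free_group unit := pres_lift (fun _ : Gam => gen _ tt).
have zetaR u v : @raag_rel Gam u v ->
    word_eval (fun _ : Gam => gen (fun _ _ : word unit => False) tt) u =
    word_eval (fun _ : Gam => gen (fun _ _ : word unit => False) tt) v.
  exact: raag_rel_word_eval.
have zetaM : {morph zeta : x y / x * y} by exact: pres_liftM.
have zeta_gen v : zeta (vgen v) = gen _ tt by exact: pres_lift_gen.
pose s : free_group unit -> raag Gam := pres_lift (fun _ => vgen r).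
have sM : {morph s : x y / x * y} by exact: pres_liftM.
have s_gen : s (gen _ tt) = vgen r by exact: pres_lift_gen.
(* Every element is its value on 1 under the action times a power of the root, so the kernel of
   [zeta] is the image of [iota]. *)
have dec w : pres_class _ w = iota (word_act a w 1) * s (zeta (pres_class _ w)).
  elim: w => [|[v b] w IH].
    by rewrite pres_class0 (morph_one iotaM) (morph_one zetaM) (morph_one sM) mulg1.
  rewrite -cat1s pres_classM zetaM sM [word_act _ _ _]/= -/(word_act a w 1).
  rewrite {1}IH; move: (word_act a w 1) (s (zeta _)) => f c.
  case: b; rewrite ?pres_class_genV -/(vgen v) /a /=.
    rewrite zeta_gen s_gen iotaM iotaE -iota_tau !mulgA.
    by rewrite !mulgVK.
  rewrite (morph_inv zetaM) (morph_inv sM) zeta_gen s_gen.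
  set f' := tau' _; have -> : f = E v * tau f' by rewrite /f' tauK' mulVKg.
  rewrite iotaM iotaE -iota_tau !mulgA mulVg mul1g.
  by rewrite mulVg mul1g.
apply: (@tower2_of_retraction _ unit Z zeta (fun _ => vgen r) psi) => //.
- exact: finite_finset.
- exact: finite_subgraph.
- by case; apply: zeta_gen.
- by move=> z; rewrite /psi zetaM (morph_inv zetaM) !zeta_gen mulgV.
- move=> g g1; exists (repr (word_act a (repr g) 1)).
  by rewrite -[LHS](repr_classK g) dec repr_classK g1 (morph_one sM) mulg1.
- move=> w w1; apply/pres_classP; rewrite pres_class0.
  rewrite -[LHS]mulg1 -act_iota; have -> : iota (pres_class _ w) = 1; last exact: act1.
  by rewrite /iota pres_lift_class.
Qed.

(** * The characterization of length 2 *)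

(** Trees are required to have two distinct vertices because the Artin group of a single vertex is
    infinite cyclic, of length 1. *)
Theorem theoremC (Gam : simple_graph) :
  poly_fg_free_of_length (raag Gam) 2 <->
  finite_graph Gam /\
  ((is_tree Gam /\ exists u v : Gam, u != v) \/ is_complete_bipartite Gam).
Proof.
split=> [lenG|[finG shapeG]].
  have not1 : ~ poly_fg_free_tower (raag Gam) 1 by move/lenG.2.
  have [m [n [iota [rho [iotaM iota_inj rhoM [rhoS kerE] [m0 n0]]]]]] :=
    length2_extension lenG.
  split; first exact: extension_finite_graph iotaM rhoM rhoS kerE.
  have [n1|n2] : n = 1%N \/ 1 < n by lia.
    by left; apply: rank_one_tree iotaM iota_inj rhoM rhoS kerE n1 not1.
  by right; apply: higher_rank_bipartite iotaM iota_inj rhoM rhoS kerE n2 not1.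
split.
  by case: shapeG => [[treeG _]|bipG]; [exact: tree_tower2 | exact: bipartite_tower2].
have [u [v uv]] : exists u v : Gam, adj u v.
  case: shapeG => [[[[_ conn] _] [u [v nuv]]]|[A [[u uA] [v vA] adjE]]].
    have [[|x p] /= up pv] := conn u v; first by rewrite pv eqxx in nuv.
    by exists u, x; case/andP: up.
  by exists u, v; rewrite adjE uA (negbTE vA).
by move=> M; apply: edge_no_short_tower uv.
Qed.
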